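(* Let $r\ge3$ and let $Q$ be a finite generating set of $\mathrm{Out}(F_r)$ such that $Q=Q^{-1}$. Then there exists a constant $c>0$ such that, for $\mu_{\mathcal W}$-a.e. trajectory $\omega=\theta_1,\theta_2,\dots$ of $\mathcal W$, \[\lim_{n\to\infty}\frac1n|\theta_n\cdots\theta_1|_Q=c.\]
   Context: $F_r$ is the free group with fixed free basis $A=\{a_1,\dots,a_r\}$. An elementary Nielsen automorphism is $\theta\in\mathrm{Aut}(F_r)$ for which there are $x,y\in A^{\pm1}$, $y\ne x^{\pm1}$, with $\theta(x)=yx$ and $\theta(z)=z$ for all $z\in A^{\pm1}\setminus\{x,x^{-1}\}$; write $\theta=[x\mapsto yx]$. Let $S$ be the set of all of these. An ordered pair $([x\mapsto yx],[x'\mapsto y'x'])$ is admissible if either $x'=x$ and $y'\ne y^{-1}$, or $y'=x$ and $x'\ne y^{-1}$. For every $\theta\in S$ there are exactly $4r-6$ elements $\theta'\in S$ with $(\theta,\theta')$ admissible. $\mathcal W$ is the Markov chain with state set $S$, with initial distribution uniform on $S$, and with transition probability from $\theta$ to $\theta'$ equal to $1/(4r-6)$ if $(\theta,\theta')$ is admissible and $0$ otherwise. A trajectory is a sequence $\theta_1,\theta_2,\dots\in S^{\mathbb N}$ and $\mu_{\mathcal W}$ is the probability measure on $S^{\mathbb N}$ defined by $\mathcal W$. For $\phi\in\mathrm{Out}(F_r)$, $|\phi|_Q$ is the distance from $1$ to $\phi$ in the word metric on $\mathrm{Out}(F_r)$ corresponding to $Q$; the product $\theta_n\cdots\theta_1$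 is regarded as an element of $\mathrm{Out}(F_r)$. *)

(* Defs.v *)
From HB Require Import structures.
From mathcomp Require Import all_boot all_order all_algebra.
From mathcomp Require Import all_classical all_reals all_analysis.

Set Implicit Arguments.
Unset Strict Implicit.
Unset Printing Implicit Defensive.

Import Order.TTheory GRing.Theory Num.Theory.
Import numFieldNormedType.Exports.

Local Open Scope classical_set_scope.

Section FreeGroup.
Variable r : nat.

(* (i, false) is the basis element a_i and (i, true) is its inverse. *)
Definition letter := ('I_r * bool)%type.
Definition linv (x : letter) : letter := (x.1, ~~ x.2).

Lemma linvK : involutive linv.
Proof. by case=> i b; rewrite /linv /= negbK. Qed.

Lemma linv_neq (x : letter) : linv x != x.
Proof. by case: x => i []; apply/eqP => -[]. Qed.

Lemma linv_eq (x y : letter) : (linv x == linv y) = (x == y).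
Proof. exact: (inj_eq (can_inj linvK)). Qed.

Definition reduced (w : seq letter) := sorted [rel x y | y != linv x] w.

Record free_group := FreeGroup { fg_word : seq letter; _ : reduced fg_word }.
HB.instance Definition _ := [isSub for fg_word].
HB.instance Definition _ := [Countable of free_group by <:].

Definition lmul (x : letter) (w : seq letter) : seq letter :=
  if w is y :: w' then if y == linv x then w' else x :: w else [:: x].

Lemma reduced_behead x w : reduced (x :: w) -> reduced w.
Proof. exact: path_sorted. Qed.

Lemma reduced_lmul x w : reduced w -> reduced (lmul x w).
Proof.
case: w => [//|y w] /= yw; case: ifPn => [_|xy]; first exact: path_sorted yw.
by rewrite /= xy.
Qed.

Lemma lmulK x w : reduced w -> lmul x (lmul (linv x) w) = w.
Proof.
case: w => [|y w]; first by rewrite /lmul eqxx.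
rewrite {2}/lmul linvK; case: eqP => [-> xw|yx _]; last by rewrite /lmul eqxx.
by case: w xw => [//|z w] /= /andP[/negbTE ->].
Qed.

Lemma reduced_foldr u v : reduced v -> reduced (foldr lmul v u).
Proof. by move=> rv; elim: u => //= x u IHu; exact: reduced_lmul. Qed.

Lemma foldr_lmul w x u : reduced w -> reduced u ->
  foldr lmul w (lmul x u) = lmul x (foldr lmul w u).
Proof.
move=> rw; case: u => //= y u yu.
case: eqP => [->|//]; rewrite lmulK //; exact: reduced_foldr.
Qed.

Lemma foldr_reduced u : reduced u -> foldr lmul [::] u = u.
Proof.
elim: u => //= x u IHu xu; rewrite IHu; last exact: path_sorted xu.
by case: u xu {IHu} => //= y u /andP[/negbTE ->].
Qed.

Definition winv (w : seq letter) := rev (map linv w).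

Lemma reduced_winv w : reduced w -> reduced (winv w).
Proof.
rewrite /reduced /winv rev_sorted sorted_map.
apply: sub_sorted => x y /=; apply: contra => /eqP.
by move/(can_inj linvK) => ->; rewrite linvK.
Qed.

Lemma foldr_winv u : foldr lmul u (winv u) = [::].
Proof.
elim: u => //= x u; rewrite /winv /= rev_cons foldr_rcons.
by rewrite /lmul linvK eqxx.
Qed.

Definition fg_one := @FreeGroup [::] isT.
Definition fg_mul (u v : free_group) : free_group :=
  FreeGroup (reduced_foldr (fg_word u) (valP v)).
Definition fg_inv (u : free_group) : free_group :=
  FreeGroup (reduced_winv (valP u)).

Lemma fg_mulA : associative fg_mul.
Proof.
move=> [u ru] [v rv] [w rw]; apply: val_inj => /=.
elim: u {ru} => //= x u ->.
by rewrite foldr_lmul //; exact: reduced_foldr.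
Qed.

Lemma fg_mul1 : left_id fg_one fg_mul.
Proof. by move=> u; apply: val_inj. Qed.

Lemma fg_mulr1 : right_id fg_one fg_mul.
Proof. by case=> u ru; apply: val_inj; exact: foldr_reduced. Qed.

Lemma fg_mulV : left_inverse fg_one fg_inv fg_mul.
Proof. by case=> u ru; apply: val_inj; exact: foldr_winv. Qed.

Lemma fg_invK : involutive fg_inv.
Proof.
case=> u ru; apply: val_inj => /=; rewrite /winv map_rev revK -map_comp.
by rewrite -[RHS]map_id; apply: eq_map => x /=; exact: linvK.
Qed.

Lemma fg_mulrV : right_inverse fg_one fg_inv fg_mul.
Proof. by move=> u; rewrite -{1}[u]fg_invK fg_mulV. Qed.

HB.instance Definition _ :=
  isGroup.Build free_group fg_mulA fg_mul1 fg_mulr1 fg_mulV fg_mulrV.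

Definition fg_gen (x : letter) : free_group := @FreeGroup [:: x] isT.

End FreeGroup.

Arguments fg_gen {r}.

Section AutOut.
Variable G : groupType.
Local Open Scope group_scope.

Definition is_aut (f : G -> G) := {morph f : u v / u * v} /\ bijective f.

Record autg := Autg { autg_fun :> G -> G; _ : `[< is_aut autg_fun >] }.
HB.instance Definition _ := [isSub for autg_fun].
HB.instance Definition _ := [Choice of autg by <:].

Lemma autgP (f : autg) : is_aut f.
Proof. exact/asboolP/(valP f). Qed.

Lemma autgM (f : autg) : {morph f : u v / u * v}.
Proof. by case: (autgP f). Qed.

Lemma autg_ext (f g : autg) : f =1 g -> f = g.
Proof. by move=> fg; apply: val_inj; apply: funext. Qed.

Definition mk_autg (f : G -> G) (fP : is_aut f) : autg := Autg (asboolT fP).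

Fact autg_inv_exists (f : autg) : exists g : G -> G, cancel f g /\ cancel g f.
Proof. by case: (autgP f) => _ [g fK gK]; exists g. Qed.

Definition autg_inv_fun (f : autg) : G -> G := projT1 (cid (autg_inv_exists f)).

Lemma autg_funK (f : autg) : cancel f (autg_inv_fun f).
Proof. by rewrite /autg_inv_fun; case: cid => ? []. Qed.

Lemma autg_inv_funK (f : autg) : cancel (autg_inv_fun f) f.
Proof. by rewrite /autg_inv_fun; case: cid => ? []. Qed.

Fact autg_one_subproof : is_aut (@id G).
Proof. by split=> //; exists id. Qed.

Fact autg_mul_subproof (f g : autg) : is_aut (f \o g).
Proof.
split; last by apply: bij_comp; [case: (autgP f)|case: (autgP g)].
by move=> u v /=; rewrite !autgM.
Qed.

Fact autg_inv_subproof (f : autg) : is_aut (autg_inv_fun f).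
Proof.
split; last by exists f; [exact: autg_inv_funK|exact: autg_funK].
by move=> u v; apply: (can_inj (autg_funK f)); rewrite autgM !autg_inv_funK.
Qed.

Definition autg_one := mk_autg autg_one_subproof.
Definition autg_mul (f g : autg) := mk_autg (autg_mul_subproof f g).
Definition autg_inv (f : autg) := mk_autg (autg_inv_subproof f).

Fact autg_mulA : associative autg_mul.
Proof. by move=> f g h; exact: autg_ext. Qed.
Fact autg_mul1 : left_id autg_one autg_mul.
Proof. by move=> f; exact: autg_ext. Qed.
Fact autg_mulr1 : right_id autg_one autg_mul.
Proof. by move=> f; exact: autg_ext. Qed.
Fact autg_mulV : left_inverse autg_one autg_inv autg_mul.
Proof. by move=> f; apply: autg_ext => u; exact: autg_funK. Qed.
Fact autg_mulrV : right_inverse autg_one autg_inv autg_mul.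
Proof. by move=> f; apply: autg_ext => u; exact: autg_inv_funK. Qed.

HB.instance Definition _ :=
  isGroup.Build autg autg_mulA autg_mul1 autg_mulr1 autg_mulV autg_mulrV.

Lemma autgE (f g : autg) u : (f * g) u = f (g u). Proof. by []. Qed.
Lemma autg1E u : (1 : autg) u = u. Proof. by []. Qed.

Fact inner_subproof (w : G) : is_aut (fun u => w * u * w^-1).
Proof.
split; first by move=> u v; rewrite !mulgA mulgVK.
exists (fun u => w^-1 * u * w) => u; rewrite !mulgA ?mulVg ?mulgV mul1g.
  by rewrite -mulgA mulVg mulg1.
by rewrite -mulgA mulgV mulg1.
Qed.

Definition inner (w : G) : autg := mk_autg (inner_subproof w).

Definition out_rel (f g : autg) : bool := `[< exists w, f = inner w * g >].

Lemma innerM : {morph inner : v w / v * w}.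
Proof. by move=> v w; apply: autg_ext => u; rewrite /= !invgM !mulgA. Qed.

Lemma inner1 : inner 1 = 1.
Proof. by apply: autg_ext => u; rewrite /= mul1g invg1 mulg1. Qed.

Lemma autg_inner (f : autg) w : f * inner w = inner (f w) * f.
Proof.
apply: autg_ext => u /=; rewrite !autgM; congr (_ * _).
apply: (mulgI (f w)); rewrite mulgV -autgM mulgV.
by apply: (mulgI (f 1)); rewrite -autgM !mulg1.
Qed.

Fact out_rel_refl : reflexive out_rel.
Proof. by move=> f; apply/asboolP; exists 1; rewrite inner1 mul1g. Qed.

Fact out_rel_sym : symmetric out_rel.
Proof.
suff imp f g : out_rel f g -> out_rel g f by move=> f g; apply/idP/idP; exact: imp.
move=> /asboolP[w ->]; apply/asboolP; exists w^-1.
by rewrite mulgA -innerM mulVg inner1 mul1g.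
Qed.

Fact out_rel_trans : transitive out_rel.
Proof.
move=> g f h /asboolP[v ->] /asboolP[w ->]; apply/asboolP; exists (v * w).
by rewrite innerM mulgA.
Qed.

Canonical out_equiv := EquivRel out_rel out_rel_refl out_rel_sym out_rel_trans.

Local Open Scope quotient_scope.

Definition outg := {eq_quot out_equiv}.
HB.instance Definition _ := Choice.on outg.
HB.instance Definition _ := EqQuotient.on outg.

Definition to_out (f : autg) : outg := \pi_outg f.

Lemma to_outP f g : to_out f = to_out g <-> exists w, f = inner w * g.
Proof.
split; last by move=> fg; apply/eqquotP/asboolP.
by move=> /eqquotP /asboolP.
Qed.

Lemma to_outK (a : outg) : to_out (repr a) = a. Proof. exact: reprK. Qed.

Definition outg_one : outg := to_out 1.
Definition outg_mul (a b : outg) : outg := to_out (repr a * repr b).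
Definition outg_inv (a : outg) : outg := to_out (repr a)^-1.

Lemma outg_mulE f g : outg_mul (to_out f) (to_out g) = to_out (f * g).
Proof.
apply/to_outP.
have /to_outP[v ->] := to_outK (to_out f).
have /to_outP[w ->] := to_outK (to_out g).
by exists (v * f w); rewrite innerM -!mulgA (mulgA f) autg_inner !mulgA.
Qed.

Lemma outg_invE f : outg_inv (to_out f) = to_out f^-1.
Proof.
apply/to_outP; have /to_outP[v ->] := to_outK (to_out f).
exists (f^-1 v^-1); rewrite invgM -autg_inner; congr (_ * _).
by apply: (mulgI (inner v)); rewrite mulgV -innerM mulgV inner1.
Qed.

Fact outg_mulA : associative outg_mul.
Proof.
move=> a b c; rewrite -[a]to_outK -[b]to_outK -[c]to_outK.
by rewrite !outg_mulE mulgA.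
Qed.
Fact outg_mul1 : left_id outg_one outg_mul.
Proof. by move=> a; rewrite -[a]to_outK outg_mulE mul1g. Qed.
Fact outg_mulr1 : right_id outg_one outg_mul.
Proof. by move=> a; rewrite -[a]to_outK outg_mulE mulg1. Qed.
Fact outg_mulV : left_inverse outg_one outg_inv outg_mul.
Proof. by move=> a; rewrite -[a]to_outK outg_invE outg_mulE mulVg. Qed.
Fact outg_mulrV : right_inverse outg_one outg_inv outg_mul.
Proof. by move=> a; rewrite -[a]to_outK outg_invE outg_mulE mulgV. Qed.

HB.instance Definition _ :=
  isGroup.Build outg outg_mulA outg_mul1 outg_mulr1 outg_mulV outg_mulrV.

Lemma to_outM : {morph to_out : f g / f * g}.
Proof. by move=> f g; rewrite -outg_mulE. Qed.

End AutOut.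

Section WordMetric.
Variable G : groupType.
Local Open Scope group_scope.

Definition generates (Q : set G) :=
  forall H : {pred G}, group_closed H -> (forall q, Q q -> q \in H) ->
  forall g, g \in H.

Definition path_length (Q : set G) (g h : G) (n : nat) : Prop :=
  exists s : seq G,
    [/\ size s = n, forall q, q \in s -> Q q & h = g * \prod_(q <- s) q].

(* Junk value 0 when h is not in g <Q>. *)
Definition word_dist (Q : set G) (g h : G) : nat :=
  if pselect (exists n, `[< path_length Q g h n >]) is left ex
  then ex_minn ex else 0.

End WordMetric.

Section Nielsen.
Variable r : nat.
Local Open Scope group_scope.
Local Notation F := (free_group r).
Local Notation gen := (@fg_gen r).

Definition fg_lift (G : groupType) (f : letter r -> G) (w : F) : G :=
  \prod_(x <- fg_word w) f x.

Lemma fg_liftM (G : groupType) (f : letter r -> G) :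
  (forall x, f (linv x) = (f x)^-1) -> {morph fg_lift f : u v / u * v}.
Proof.
move=> fV [u ru] v; rewrite /fg_lift /=.
elim: u {ru} => [|x u IHu] /=; first by rewrite big_nil mul1g.
rewrite big_cons -mulgA -IHu.
case: (foldr _ _ u) => [|y w] /=; first by rewrite big_seq1 big_nil mulg1.
by case: eqP => [->|_]; rewrite !big_cons // fV mulVKg.
Qed.

Lemma fg_lift_gen (G : groupType) (f : letter r -> G) x :
  fg_lift f (gen x) = f x.
Proof. by rewrite /fg_lift big_seq1. Qed.

Lemma fg_gen_linv x : gen (linv x) = (gen x)^-1.
Proof. exact: val_inj. Qed.

Lemma fg_liftE (u : F) : fg_lift gen u = u.
Proof.
case: u => u ru; apply: val_inj; rewrite /fg_lift /=.
rewrite -[RHS](foldr_reduced ru).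
by elim: u {ru} => [|x u IHu] /=; rewrite ?big_nil // big_cons -IHu.
Qed.

Lemma fg_hom_lift (G : groupType) (h : F -> G) : {morph h : u v / u * v} ->
  h =1 fg_lift (h \o gen).
Proof.
move=> hM u; rewrite -{1}[u]fg_liftE /fg_lift.
elim: (fg_word u) => [|x w IHw]; last by rewrite !big_cons hM IHw.
by rewrite !big_nil; apply: (mulgI (h 1)); rewrite -hM !mulg1.
Qed.

Lemma fg_hom_ext (G : groupType) (h k : F -> G) :
  {morph h : u v / u * v} -> {morph k : u v / u * v} ->
  (forall x, h (gen x) = k (gen x)) -> h =1 k.
Proof.
move=> hM kM hk u; rewrite (fg_hom_lift hM) (fg_hom_lift kM).
by rewrite /fg_lift; apply: eq_bigr => x _; exact: hk.
Qed.

Definition nielsen_img (x y z : letter r) : F :=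
  if z == x then gen y * gen x
  else if z == linv x then (gen x)^-1 * (gen y)^-1 else gen z.

Definition nielsen_fun x y : F -> F := fg_lift (nielsen_img x y).

Lemma nielsen_imgV x y z : nielsen_img x y (linv z) = (nielsen_img x y z)^-1.
Proof.
rewrite /nielsen_img linv_eq -[linv z == x]linv_eq linvK.
have [->|zx] := eqVneq z x.
  by rewrite eq_sym (negbTE (linv_neq _)) invgM.
by case: eqVneq => _; rewrite ?invgM ?invgK // fg_gen_linv.
Qed.

Lemma nielsen_funM x y : {morph nielsen_fun x y : u v / u * v}.
Proof. exact/fg_liftM/nielsen_imgV. Qed.

Definition nielsen_ok (p : letter r * letter r) :=
  (p.2 != p.1) && (p.2 != linv p.1).

Lemma nielsen_funV x y (u : F) : nielsen_ok (x, y) -> 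
  nielsen_fun x y (nielsen_fun x (linv y) u) = u.
Proof.
move=> /andP[/= yx yxV].
suff : nielsen_fun x y \o nielsen_fun x (linv y) =1 id by exact.
apply: fg_hom_ext => //; first by move=> v w /=; rewrite !nielsen_funM.
have fV w : nielsen_fun x y w^-1 = (nielsen_fun x y w)^-1.
  apply: (mulgI (nielsen_fun x y w)); rewrite -nielsen_funM !mulgV.
  by rewrite /nielsen_fun /fg_lift big_nil.
have fy : nielsen_fun x y (gen y) = gen y.
  by rewrite /nielsen_fun fg_lift_gen /nielsen_img (negbTE yx) (negbTE yxV).
have fx : nielsen_fun x y (gen x) = gen y * gen x.
  by rewrite /nielsen_fun fg_lift_gen /nielsen_img eqxx.
move=> z /=; rewrite {2}/nielsen_fun fg_lift_gen {1}/nielsen_img.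
have [->|zx] := eqVneq z x.
  by rewrite nielsen_funM fg_gen_linv fV fy fx mulKg.
have [->|zxV] := eqVneq z (linv x).
  rewrite nielsen_funM fg_gen_linv invgK fV fy fx invgM -mulgA mulVg mulg1.
  by rewrite ?fg_gen_linv.
by rewrite /nielsen_fun fg_lift_gen /nielsen_img (negbTE zx) (negbTE zxV).
Qed.

Lemma nielsen_ok_linv x y : nielsen_ok (x, linv y) = nielsen_ok (x, y).
Proof.
by rewrite /nielsen_ok /= andbC linv_eq -[linv y == x]linv_eq linvK.
Qed.

Fact nielsen_is_aut x y : nielsen_ok (x, y) -> is_aut (nielsen_fun x y).
Proof.
move=> xy; split; first exact: nielsen_funM.
exists (nielsen_fun x (linv y)) => u; last exact: nielsen_funV.
by rewrite -{2}(linvK y) nielsen_funV // nielsen_ok_linv.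
Qed.

(* The state set S: the pair (x, y) is the name of [x |-> yx]; distinct pairs
   name distinct automorphisms by nielsen_aut_inj. *)
Definition nielsen := {p : letter r * letter r | nielsen_ok p}.
HB.instance Definition _ := Finite.on nielsen.

Definition nielsen_src (s : nielsen) : letter r := (val s).1.
Definition nielsen_mul (s : nielsen) : letter r := (val s).2.

Definition nielsen_aut (s : nielsen) : autg F :=
  mk_autg (nielsen_is_aut (valP s : nielsen_ok (nielsen_src s, nielsen_mul s))).

Definition is_nielsen (x y : letter r) (f : autg F) : Prop :=
  f (gen x) = gen y * gen x /\
  forall z, z != x -> z != linv x -> f (gen z) = gen z.

Lemma nielsen_autP (s : nielsen) : is_nielsen (nielsen_src s) (nielsen_mul s) (nielsen_aut s).
Proof.
split=> [|z zx zxV] /=; rewrite /nielsen_fun fg_lift_gen /nielsen_img ?eqxx //.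
by rewrite (negbTE zx) (negbTE zxV).
Qed.

Lemma is_nielsen_uniq x y (f g : autg F) :
  is_nielsen x y f -> is_nielsen x y g -> f = g.
Proof.
move=> [fx fz] [gx gz]; apply: autg_ext; apply: fg_hom_ext; try exact: autgM.
have V (h : autg F) u : h u^-1 = (h u)^-1.
  apply: (mulgI (h u)); rewrite -autgM !mulgV.
  by apply: (mulgI (h 1)); rewrite -autgM !mulg1.
move=> z; have [->|zx] := eqVneq z x; first by rewrite fx gx.
have [->|zxV] := eqVneq z (linv x); last by rewrite fz ?gz.
by rewrite fg_gen_linv !V fx gx.
Qed.

Lemma nielsen_autE x y (f : autg F) : nielsen_ok (x, y) -> is_nielsen x y f ->
  exists2 s : nielsen, val s = (x, y) & f = nielsen_aut s.
Proof.
move=> xy fxy; pose s : nielsen := exist _ (x, y) xy; exists s => //.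
exact: is_nielsen_uniq fxy (nielsen_autP s).
Qed.

Lemma fg_word_gen2 x y : y != linv x -> fg_word (gen y * gen x) = [:: y; x].
Proof.
move=> yx /=; case: eqP => // xy.
by move: yx; rewrite xy linvK eqxx.
Qed.

Lemma nielsen_aut_inj : injective nielsen_aut.
Proof.
move=> s t; have := nielsen_autP s; have := nielsen_autP t.
case: s t => [[x y] /= xy] [[x' y'] /= xy'] t_ s_ st.
rewrite -{}st /nielsen_src /nielsen_mul /= in t_ s_.
have /andP[/= yx yxV] := xy; have /andP[/= yx' yxV'] := xy'.
case: s_ t_ => sx sz [tx tz].
apply: val_inj => /=.
move: sx sz tx tz; set f := nielsen_aut _ => sx sz tx tz.
have fV u : f u^-1 = (f u)^-1.
  apply: (mulgI (f u)); rewrite -autgM !mulgV.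
  by apply: (mulgI (f 1)); rewrite -autgM !mulg1.
have [xx|nxx] := eqVneq x x'.
  rewrite -xx; move: tx; rewrite -xx sx => /(congr1 (fun u => u * (gen x)^-1)).
  by rewrite !mulgK => -[->].
have [xx|nxx'] := eqVneq x (linv x').
  move: sx; rewrite xx fg_gen_linv fV tx invgM -!fg_gen_linv.
  move=> /(congr1 (@fg_word r)); rewrite !fg_word_gen2 -?xx //.
    by move/eqP; rewrite eqseq_cons eq_sym (negbTE yx).
  by rewrite linvK xx eq_sym.
move: sx; rewrite tz // => /(congr1 (@fg_word r)).
by rewrite fg_word_gen2.
Qed.

Definition admissible (s t : nielsen) : bool :=
  (nielsen_src t == nielsen_src s) && (nielsen_mul t != linv (nielsen_mul s))
  || (nielsen_mul t == nielsen_src s) && (nielsen_src t != linv (nielsen_mul s)).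

End Nielsen.

Section NielsenCount.
Variable r : nat.

Lemma card_letter : #|{: letter r}| = (2 * r)%N.
Proof. by rewrite card_prod card_ord card_bool mulnC. Qed.

Lemma nielsen_okP (s : nielsen r) :
  nielsen_ok (nielsen_src s, nielsen_mul s).
Proof. exact: (valP s). Qed.

Lemma card_admissible (s : nielsen r) :
  #|[set t | admissible s t]%SET| = (4 * r - 6)%N.
Proof.
pose x := nielsen_src s; pose y := nielsen_mul s.
have /andP[/= yx yxV] := nielsen_okP s; rewrite -/x -/y in yx yxV.
pose C : {set letter r} := (~: [set x; linv x; linv y])%SET.
have CE z : (z \in C) = [&& z != x, z != linv x & z != linv y].
  by rewrite !inE !negb_or andbA.
have cC : #|C| = (2 * r - 3)%N.
  have := cardsC [set x; linv x; linv y]%SET; rewrite -/C card_letter => <-.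
  rewrite -finset.setUA cardsU1 cardsU1 cards1 !inE linv_eq negb_or.
  rewrite -[x == linv y]linv_eq linvK.
  by rewrite ![_ == y]eq_sym yx yxV eq_sym linv_neq /= addKn.
have xC : x \notin C by rewrite CE eqxx.
have -> : #|[set t | admissible s t]%SET| =
    #|(pair x @: C :|: (pair^~ x) @: C)%SET|.
  rewrite -(card_imset _ val_inj); apply: eq_card => p.
  apply/imsetP/setUP => [[t]|].
    rewrite inE /admissible -/x -/y => st ->.
    have /andP[/= tx txV] := nielsen_okP t; move: st tx txV.
    rewrite [val t]surjective_pairing -/(nielsen_src t) -/(nielsen_mul t).
    case/orP=> /andP[/eqP e ne]; rewrite !e => tx txV; [left|right];
        apply: imset_f; rewrite CE ne ?tx ?txV // eq_sym tx /= andbT.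
    by rewrite -[nielsen_src t]linvK linv_eq eq_sym.
  case=> /imsetP[z]; rewrite CE => /and3P[zx zxV zy] ->.
    have ok : nielsen_ok (x, z) by rewrite /nielsen_ok /= zx zxV.
    by exists (exist _ (x, z) ok) => //; rewrite inE /admissible /= eqxx zy.
  have ok : nielsen_ok (z, x).
    by rewrite /nielsen_ok /= eq_sym zx /= -[x]linvK linv_eq eq_sym.
  exists (exist _ (z, x) ok) => //.
  by rewrite inE /admissible /= eqxx zy orbT.
rewrite cardsU (_ : (_ :&: _)%SET = finset.set0); last first.
  apply/finset.setP => -[u v]; rewrite !inE; apply/negbTE/negP => /andP[].
  move=> /imsetP[z zC [-> ->]] /imsetP[z' z'C [xz' _]].
  by move: xC; rewrite xz' z'C.
rewrite cards0 subn0 !card_imset ?cC; first by rewrite addnn -mul2n mulnBr mulnA.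
  by move=> u v [].
by move=> u v [].
Qed.

Lemma nielsen_inhabited : (2 < r)%N -> exists s : nielsen r, True.
Proof.
move=> r3; pose i := Ordinal (ltnW (ltnW r3)); pose j := Ordinal (ltnW r3).
by exists (exist _ ((i, false), (j, false)) isT).
Qed.

End NielsenCount.

Section Chain.
Variables (R : realType) (r : nat).
Local Open Scope ring_scope.

Definition chain_init (s : nielsen r) : R := #|{: nielsen r}|%:R^-1.

Definition chain_trans (s t : nielsen r) : R :=
  if admissible s t then (4 * r - 6)%:R^-1 else 0.

(* The class of theta_n o ... o theta_1, where theta_(i+1) = w i. *)
Definition walk (w : nat -> nielsen r) (n : nat) : outg (free_group r) :=
  iteri n (fun i phi => to_out (nielsen_aut (w i)) * phi)%g 1%g.

End Chain.

(* The product sigma-algebra of the discrete ones. *)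
Definition coordinate_sets (S : Type) : set (set (nat -> S)) :=
  [set C | exists i (B : set S), C = [set w | B (w i)]].

(* S^N, with theta_(i+1) = w i. The bound on r only serves to make the type
   nonempty, as is required of a measurableType. *)
Definition trajectory r (hr : (2 < r)%N) := nat -> nielsen r.

HB.instance Definition _ r (hr : (2 < r)%N) :=
  gen_eqMixin (trajectory hr).
HB.instance Definition _ r (hr : (2 < r)%N) :=
  gen_choiceMixin (trajectory hr).
HB.instance Definition _ r (hr : (2 < r)%N) :=
  isPointed.Build (trajectory hr) (fun=> projT1 (cid (nielsen_inhabited hr))).

Definition trajectories r (hr : (2 < r)%N) :=
  g_sigma_algebraType (@coordinate_sets (nielsen r) : set (set (trajectory hr))).
HB.instance Definition _ r (hr : (2 < r)%N) := Measurable.on (trajectories hr).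

Definition is_chain_law (R : realType) r (hr : (2 < r)%N)
    (mu : probability (trajectories hr) R) : Prop :=
  forall n (s : nat -> nielsen r),
    mu [set w | forall i, (i <= n)%N -> w i = s i] =
    (chain_init R (s 0) * \prod_(i < n) chain_trans R (s i) (s i.+1))%:E%R.

(* Existence of the law, as the image of the uniform measure on [0, 1[ under
   successive digit extraction. *)
Section ChainExistence.
Variables (R : realType) (r : nat).
Variable hr : (2 < r)%N.
Local Open Scope ring_scope.
Local Notation S := (nielsen r).
Implicit Types (l : seq S) (s : nat -> S) (u x : R).

Let s0 : S := projT1 (cid (nielsen_inhabited hr)).

Let digit l u : nat := Num.truncn ((size l)%:R * u).
Let step l u : S * R := (nth s0 l (digit l u), (size l)%:R * u - (digit l u)%:R).
Let succs (t : S) : seq S := enum [set t' | admissible t t']%SET.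
Let st x := fix st n := if n is n'.+1
  then step (succs (st n').1) (st n').2 else step (enum {: S}) x.

Let size_succs t : size (succs t) = (4 * r - 6)%N.
Proof. by rewrite -cardE card_admissible. Qed.

Let dgt0 : (0 < 4 * r - 6)%N.
Proof. by rewrite subn_gt0 (@leq_trans (4 * 2)) // leq_mul2l ltnW. Qed.

Let Ngt0 : (0 < #|{: S}|)%N. Proof. by apply/card_gt0P; exists s0. Qed.

Let step_itv l u : (0 < size l)%N -> 0 <= u < 1 ->
  ((step l u).1 \in l) /\ 0 <= (step l u).2 < 1.
Proof.
move=> l0 /andP[u0 u1]; rewrite /step /=.
have m0 : 0 < (size l)%:R :> R by rewrite ltr0n.
have /truncn_itv/andP[h1 h2] : 0 <= (size l)%:R * u by rewrite mulr_ge0.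
split; last by rewrite subr_ge0 h1 /= ltrBlDr addrC -natr1 addrC in h2 *.
apply: mem_nth; rewrite -(ltr_nat R) (le_lt_trans h1) //.
by rewrite -[ltRHS]mulr1 ltr_pM2l.
Qed.

Let step_eq l u t : uniq l -> t \in l -> 0 <= u < 1 ->
  ((step l u).1 = t <-> (index t l)%:R <= (size l)%:R * u < (index t l).+1%:R).
Proof.
move=> ul tl u01; have l0 : (0 < size l)%N by case: (l) tl.
have [sl _] := step_itv l0 u01; case/andP: u01 => u0 u1.
have h : 0 <= (size l)%:R * u by rewrite mulr_ge0.
split=> [<-|/truncn_def e]; last by rewrite /= /digit e nth_index.
rewrite /= index_uniq ?truncn_itv // /digit.
rewrite -(ltr_nat R) (@le_lt_trans _ _ ((size l)%:R * u)) //.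
  by case/andP: (truncn_itv h).
by rewrite -[ltRHS]mulr1 ltr_pM2l // ltr0n.
Qed.

Let st_itv x n : 0 <= x < 1 -> 0 <= (st x n).2 < 1.
Proof.
move=> x01; elim: n => [|n IHn] /=.
  by apply: (proj2 (step_itv _ x01)); rewrite -cardE.
by apply: (proj2 (step_itv _ IHn)); rewrite size_succs.
Qed.

Let hit n s x := forall i, (i <= n)%N -> (st x i).1 = s i.

Let hitS n s x : hit n.+1 s x <-> hit n s x /\ (st x n.+1).1 = s n.+1.
Proof.
split=> [h|[h e] i]; first by split=> [i /leqW|]; exact: h.
by rewrite leq_eqVlt => /predU1P[->//|/h].
Qed.

Let len n s := chain_init R (s 0%N) * \prod_(i < n) chain_trans R (s i) (s i.+1).

Let len_ge0 n s : 0 <= len n s.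
Proof.
rewrite mulr_ge0 ?invr_ge0 // prodr_ge0 // => i _.
by rewrite /chain_trans; case: ifP; rewrite ?invr_ge0.
Qed.

Let sub_itv (a L m k : R) (u x : R) : 0 < m -> 0 < L -> u * L = x - a ->
  (k <= m * u < k + 1) = (a + k * (L / m) <= x < a + k * (L / m) + L / m).
Proof.
move=> m0 L0 uL; have -> : u = (x - a) / L by rewrite -uL mulfK ?gt_eqF.
have Lm : 0 < L / m by rewrite divr_gt0.
have -> : m * ((x - a) / L) = (x - a) / (L / m).
  by rewrite invf_div mulrCA.
rewrite ler_pdivlMr // ltr_pdivrMr // mulrDl mul1r lerBrDl ltrBlDl addrA.
by [].
Qed.

Let hit_itv n s : exists a, [/\ 0 <= a, a + len n s <= 1 &
  forall x, 0 <= x < 1 -> (hit n s x <-> a <= x < a + len n s) /\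
    (hit n s x -> (st x n).2 * len n s = x - a)].
Proof.
elim: n => [|n [a [a0 a1 ah]]].
  set l := enum {: S}; set k := index (s 0%N) l; set m : R := #|{: S}|%:R.
  have m0 : 0 < m by rewrite ltr0n.
  have sl : (size l)%:R = m by rewrite -cardE.
  have sl0 : s 0%N \in l by rewrite mem_enum.
  have kl : (k < size l)%N by rewrite index_mem.
  have -> : len 0 s = m^-1 by rewrite /len big_ord0 mulr1.
  exists (k%:R / m); split.
  - by rewrite divr_ge0 // ltW.
  - rewrite -[X in _ + X]mul1r -mulrDl ler_pdivrMr // mul1r natr1.
    by rewrite -sl ler_nat.
  - move=> x x01; have hE : hit 0 s x <-> (step l x).1 = s 0%N.
      split=> [/(_ 0%N)->//|e i]; by rewrite leqn0 => /eqP ->.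
    have se := step_eq (enum_uniq _) sl0 x01.
    split.
      apply: (iff_trans hE); apply: (iff_trans se).
      rewrite -/l -/k sl -natr1 (@sub_itv 0 1 m _ x x) ?subr0 ?mulr1 //.
      by rewrite add0r div1r.
    move=> /hE e /=; rewrite -/l.
    have dk : digit l x = k.
      by apply: truncn_def; apply/(proj1 se).
    by rewrite dk sl mulrBl mulrAC divff ?mul1r // gt_eqF.
have lenS : len n.+1 s = len n s * chain_trans R (s n) (s n.+1).
  by rewrite /len big_ord_recr mulrA.
rewrite lenS /chain_trans; case: ifPn => [adm|nadm]; last first.
  exists a; rewrite mulr0 addr0; split => //.
    by rewrite (le_trans _ a1) // lerDl.
  move=> x x01; have nh : ~ hit n.+1 s x.
    case/hitS => hn; rewrite /= hn // => e.
    have [|] := @step_itv (succs (s n)) (st x n).2 _ (st_itv n x01).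
      by rewrite size_succs.
    by rewrite /= e mem_enum inE (negbTE nadm).
  by split=> //; split=> // /andP[/le_lt_trans h /h]; rewrite ltxx.
set m : R := (4 * r - 6)%:R; set l := succs (s n); set k := index (s n.+1) l.
have m0 : 0 < m by rewrite ltr0n.
have sl : (size l)%:R = m by rewrite size_succs.
have tl : s n.+1 \in l by rewrite mem_enum inE.
have kl : (k < size l)%N by rewrite index_mem.
have L0 := len_ge0 n s; set L := len n s in ah a1 L0 *.
have Lm : 0 <= L / m by rewrite divr_ge0 // ltW.
have kL : k%:R * (L / m) + L / m <= L.
  rewrite -[X in _ + X]mul1r -mulrDl natr1 mulrCA -[leRHS]mulr1.
  by rewrite ler_wpM2l // ler_pdivrMr // mul1r -sl ler_nat.
have k0 : 0 <= k%:R * (L / m) by rewrite mulr_ge0.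
exists (a + k%:R * (L / m)); split.
- by rewrite addr_ge0.
- by rewrite -addrA (le_trans _ a1) // lerD2l.
move=> x x01; have [ahx uLx] := ah x x01.
have se := step_eq (enum_uniq _ : uniq l) tl (st_itv n x01).
rewrite -/l -/k sl -natr1 in se.
have key : hit n s x ->
    ((st x n.+1).1 = s n.+1 <->
     a + k%:R * (L / m) <= x < a + k%:R * (L / m) + L / m).
  move=> h; rewrite /= h //; apply: (iff_trans se).
  rewrite (@sub_itv a L _ _ _ x) //; last exact: uLx.
  rewrite lt_neqAle L0 andbT eq_sym; apply/eqP => Le.
  by move/ahx: h; rewrite Le addr0 => /andP[/le_lt_trans h /h]; rewrite ltxx.
split.
  split=> [/hitS[h /(key h)]//|xI]; apply/hitS.
  have h : hit n s x.
    apply/ahx; case/andP: xI => x1 x2; rewrite (le_trans _ x1) ?lerDl //=.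
    by rewrite (lt_le_trans x2) // -addrA lerD2l.
  by split=> //; exact/key.
case/hitS=> h; rewrite /= h // => /se; rewrite natr1 => itv; have dk := truncn_def itv.
rewrite /digit -/l sl dk mulrBl opprD addrA -(uLx h); congr (_ - _).
by rewrite -mulrA mulrCA [m * _]mulrC divfK ?gt_eqF.
Qed.

Let I : set (measurableTypeR R) := [set` `[(0 : R), 1[].

Let mI : measurable I. Proof. exact: measurable_itv. Qed.

Let X (x : measurableTypeR R) : trajectories hr :=
  if 0 <= x < 1 then fun n => (st x n).1 else fun=> s0.

Let hit_measurable n s : exists2 J : set (measurableTypeR R),
  measurable J & [set x | I x /\ hit n s x] = J /\
    (lebesgue_measure J = (len n s)%:E)%E.
Proof.
have [a [a0 a1 ah]] := hit_itv n s.
exists [set` `[a, a + len n s[]; first exact: measurable_itv.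
split.
  apply/seteqP; split=> x; rewrite /I /= !in_itv /=.
    by case=> x01 h; apply/(proj1 (ah x x01)).
  move=> xa; have x01 : 0 <= x < 1.
    by case/andP: xa => x1 x2; rewrite (le_trans a0 x1) (lt_le_trans x2 a1).
  by split=> //; apply/(proj1 (ah x x01)).
rewrite lebesgue_measure_itv /= lte_fin; case: ltP => [_|].
  by rewrite -EFinB addrAC subrr add0r.
rewrite gerDl => l0; congr EFin; apply/eqP; rewrite eq_le l0 len_ge0 //.
Qed.

Let X_measurable : measurable_fun setT X.
Proof.
apply: (@measurability _ _ (measurableTypeR R) (trajectories hr) setT X (@coordinate_sets S)); first exact: erefl.
move=> _ [_ [i [B ->]] <-]; rewrite setTI.
pose ext (t : {ffun 'I_i.+1 -> S}) (j : nat) : S := t (inord j).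
have -> : X @^-1` [set w | B (w i)] =
    (\bigcup_(t in [set t : {ffun 'I_i.+1 -> S} | B (ext t i)])
       [set x | I x /\ hit i (ext t) x]) `|` (~` I `&` [set x | B s0]).
  apply/seteqP; split=> x; rewrite /X /=.
    case: ifPn => x01 Bx; last by right; split=> //; rewrite /I /= in_itv; exact/negP.
    left; exists [ffun j : 'I_i.+1 => (st x j).1].
      by rewrite /= /ext ffunE inordK.
    split; first by rewrite /I /= in_itv.
    by move=> j ji; rewrite /ext ffunE inordK.
  case=> [[t Bt []]|[]]; rewrite {1}/I /= in_itv /=.
    by move=> -> h; rewrite h.
  by move/negP/negbTE => ->.
apply: measurableU.
  apply: fin_bigcup_measurable => // t _.
  by have [J mJ [-> _]] := hit_measurable i (ext t).
apply: measurableI; first exact: measurableC.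
have [Bs|Bs] := pselect (B s0).
  by rewrite (_ : [set x | B s0] = setT) //; apply/seteqP; split.
by rewrite (_ : [set x | B s0] = set0) //; apply/seteqP; split.
Qed.

Let P0 : set (trajectories hr) -> \bar R :=
  fun A => lebesgue_measure (X @^-1` A `&` I).

Let P0_0 : P0 set0 = 0%E.
Proof. by rewrite /P0 preimage_set0 set0I measure0. Qed.

Let P0_ge0 A : (0 <= P0 A)%E. Proof. exact: measure_ge0. Qed.

Let P0_sigma : semi_sigma_additive P0.
Proof.
pose Xm := MeasurableFun.Pack (MeasurableFun.Class
  (isMeasurableFun.Build _ _ _ _ X X_measurable)).
exact: (@measure_semi_sigma_additive _ _ _
  (pushforward (mrestr (@lebesgue_measure R) mI) Xm)).
Qed.

#[local] HB.instance Definition _ := isMeasure.Build _ _ _ P0 P0_0 P0_ge0 P0_sigma.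

Let P0_T : P0 setT = 1%E.
Proof.
rewrite /P0 preimage_setT setTI /I lebesgue_measure_itv /= lte_fin ltr01.
by rewrite -EFinB subr0.
Qed.

#[local] HB.instance Definition _ := Measure_isProbability.Build _ _ _ P0 P0_T.

Lemma chain_law_exists : exists mu : probability (trajectories hr) R,
  is_chain_law mu.
Proof.
exists P0 => n s; have [J _ [JE <-]] := hit_measurable n s.
rewrite -JE /= /P0; congr (lebesgue_measure _).
apply/seteqP; split=> x; rewrite /X /I /= !in_itv /=.
  by case=> h x01; split=> // i ni; have := h i ni; rewrite x01.
by case=> x01 h; split=> // i ni; rewrite x01; exact: h.
Qed.

End ChainExistence.

Section ChainUniqueness.
Variables (R : realType) (r : nat).
Variable hr : (2 < r)%N.
Local Notation S := (nielsen r).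

Let cyl n (s : nat -> S) : set (trajectories hr) :=
  [set w | forall i, (i < n)%N -> w i = s i].

Let G : set (set (trajectories hr)) :=
  [set C | C = set0 \/ exists n s, C = cyl n s].

Let cyl_coordinate i (B : set S) :
  \bigcup_(t in [set t : {ffun 'I_i.+1 -> S} | B (t ord_max)])
     cyl i.+1 (fun j => t (inord j)) = [set w | B (w i)].
Proof.
apply/seteqP; split=> w /=.
  case=> t /= Bt /(_ i (ltnSn _)) ->.
  by rewrite (_ : inord i = ord_max) //; apply: val_inj; rewrite /= inordK.
move=> Bw; exists [ffun j : 'I_i.+1 => w j]; first by rewrite /= ffunE.
by move=> j ji; rewrite ffunE inordK.
Qed.

Let measurable_cyl n s : measurable (cyl n s).
Proof.
rewrite (_ : cyl n s = \bigcap_(i in `I_n) [set w : trajectories hr | w i = s i]).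
  apply: bigcap_measurableType => i _; apply: sub_sigma_algebra.
  by exists i, [set s i].
by apply/seteqP; split.
Qed.

Let measurableG : @measurable _ (trajectories hr) = <<s G >>.
Proof.
apply/seteqP; split; apply: smallest_sub; try exact: smallest_sigma_algebra.
- move=> _ [i [B ->]]; rewrite -cyl_coordinate.
  pose T : measurableType _ := g_sigma_algebraType G.
  apply: (@fin_bigcup_measurable _ T) => // t _.
  by apply: sub_sigma_algebra; right; exists i.+1, (fun j => t (inord j)).
- by move=> _ [->|[n [s ->]]].
Qed.

Let setI_G : setI_closed G.
Proof.
suff H n s m t : (n <= m)%N -> G (cyl n s `&` cyl m t).
  move=> _ _ [->|[n [s ->]]] [->|[m [t ->]]]; rewrite ?set0I ?setI0; try by left.
  by have [/H//|/ltnW/H] := leqP n m; rewrite setIC.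
move=> nm; have [st|st] := pselect (forall i, (i < n)%N -> s i = t i).
  right; exists m, t; apply/seteqP; split=> [w []//|w h]; split=> // i ni.
  by rewrite h ?st // (leq_trans ni).
left; apply/seteqP; split=> // w [hs ht]; apply: st => i ni.
by rewrite -hs ?ht // (leq_trans ni).
Qed.

Lemma chain_law_unique (mu nu : probability (trajectories hr) R) :
  is_chain_law mu -> is_chain_law nu ->
  forall A : set (trajectories hr), measurable A -> mu A = nu A.
Proof.
move=> muP nuP; pose s0 : nat -> S := (point : trajectory hr).
have cylT : cyl 0 s0 = setT by apply/seteqP; split.
apply: (measure_unique G (fun=> cyl 0 s0)) => //.
- by move=> _; right; exists 0%N, s0.
- by rewrite cylT bigcup_const.
- move=> _ [->|[[|n] [s ->]]]; rewrite ?measure0 //; last first.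
    exact: etrans (muP n s) (esym (nuP n s)).
  have -> : cyl 0 s = setT by apply/seteqP; split.
  exact: etrans (probability_setT mu) (esym (probability_setT nu)).
- move=> _; rewrite cylT; apply: le_lt_trans (ltry 1%R).
  by rewrite le_eqVlt; apply/orP; left; apply/eqP; exact: probability_setT.
Qed.

End ChainUniqueness.

Definition chain_measure (R : realType) r (hr : (2 < r)%N) :
  probability (trajectories hr) R := projT1 (cid (chain_law_exists R hr)).

Lemma chain_measureP (R : realType) r (hr : (2 < r)%N) :
  is_chain_law (chain_measure R hr).
Proof. by rewrite /chain_measure; case: cid. Qed.

(* Main.v *)
(* Existence of the limit is the subadditive ergodic theorem, in the
   Katznelson-Weiss form: a greedy covering of [0, K[ by blocks of small slope
   shows that limsup and liminf of X_n / n coincide, once low slopes are known to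
   occur with probability 0 or 1. The shift preserves the chain because every
   state has 4r - 6 predecessors, so that the uniform law is stationary; the
   zero-one law holds because P(A | theta_1 = s) is harmonic in s when A is
   invariant, and the chain is irreducible.

   Positivity of the limit comes from the absence of cancellation along
   admissible sequences. With theta_1 = [x |-> yx], the image of y under
   theta_n ... theta_1, computed formally, is a cyclically reduced word, so that its
   length, which is minimal in its conjugacy class, is at most exponential in the
   word length of the outer class. This length doubles whenever a fixed path
   through all states is followed, and that path recurs with positive frequency. *)
Require Import Defs.
From mathcomp Require Import all_boot all_order all_algebra.
From mathcomp Require Import all_classical all_reals all_analysis.
From mathcomp Require Import measurable_realfun ring lra zify.
Import Order.TTheory GRing.Theory Num.Theory.
Import numFieldNormedType.Exports.
Set Implicit Arguments.
Unset Strict Implicit.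
Unset Printing Implicit Defensive.
Local Open Scope classical_set_scope.
Local Open Scope ring_scope.

(** * The subadditive ergodic theorem *)

Section Visits.
Context (T : Type) (f : T -> T).
Implicit Types (E : set T) (w : T) (X : nat -> T -> nat).

Definition visits E n w : nat := (\sum_(i < n) (iter i f w \in E))%N.

Lemma visits0 E w : visits E 0 w = 0%N.
Proof. by rewrite /visits big_ord0. Qed.

Lemma visitsD E n m w :
  visits E (n + m) w = (visits E n w + visits E m (iter n f w))%N.
Proof.
rewrite /visits big_split_ord /=; congr (_ + _)%N.
by apply: eq_bigr => i _; rewrite addnC iterD.
Qed.

Definition subadditive_cocycle X :=
  forall n m w, (X (n + m) w <= X n w + X m (iter n f w))%N.

Lemma subadditive_linear X B : X 0%N =1 (fun=> 0%N) -> subadditive_cocycle X ->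
  (forall w, (X 1%N w <= B)%N) -> forall n w, (X n w <= B * n)%N.
Proof.
move=> X0 Xsub X1; elim=> [|n IHn] w; first by rewrite X0.
by rewrite (leq_trans (Xsub 1%N n w)) // mulnS leq_add.
Qed.

(* Katznelson-Weiss: cut [0, K[ greedily into blocks of length at most M on
   which X has slope at most q, and single steps starting in E. *)
Lemma subadditive_cover (R : realType) X B M (q : R) E :
  X 0%N =1 (fun=> 0%N) -> subadditive_cocycle X -> (forall w, (X 1%N w <= B)%N) ->
  0 <= q ->
  (forall w, ~ E w -> exists2 n, (0 < n <= M)%N & (X n w)%:R <= q * n%:R) ->
  forall K w,
    (X K w)%:R <= q * K%:R + (B * M)%:R + (B * visits E K w)%:R :> R.
Proof.
move=> X0 Xsub X1 q0 good K; have [n Kn] := ubnP K.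
elim: n K Kn => // n IHn K Kn w.
(* A stretch no longer than a block is paid for by [B * M]; this happens once, at the end of the
   covering. *)
have [KM|MK] := leqP K M.
  apply: (@le_trans _ _ (B * M)%:R).
    by rewrite ler_nat (leq_trans (subadditive_linear X0 Xsub X1 _ _)) // leq_mul2l KM orbT.
  by rewrite -addrA [_ + (_ + _)]addrCA lerDl addr_ge0 // mulr_ge0.
have step m a : (0 < m)%N -> (m <= K)%N -> (X m w)%:R <= a :> R ->
    (X K w)%:R <= a + (q * (K - m)%:R + (B * M)%:R +
                   (B * visits E (K - m) (iter m f w))%:R).
  move=> m0 mK Xm; have := Xsub m (K - m)%N w; rewrite subnKC //.
  rewrite -(ler_nat R) natrD => /le_trans; apply.
  by apply: lerD => //; apply: IHn; lia.
(* A start in [E] costs one step, at most [B], matched by one visit. Otherwise a cheap block is cut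
   off, and the visits inside it are dropped from the count. *)
have [Ew|nEw] := pselect (E w).
  have K0 : (0 < K)%N by lia.
  have := step 1%N B%:R isT K0; rewrite ler_nat X1 => /(_ isT) /le_trans; apply.
  have -> : visits E K w = (1 + visits E (K - 1) (iter 1 f w))%N.
    rewrite -[in LHS](subnKC K0) visitsD; congr (_ + _)%N.
    by rewrite /visits big_ord1 /= mem_set.
  rewrite mulnDr muln1 natrD [leRHS]addrCA lerD2l lerD2r lerD2r.
  by rewrite ler_wpM2l // ler_nat leq_subr.
have [m /andP[m0 mM] Xm] := good w nEw.
have mK : (m <= K)%N by lia.
apply: (le_trans (step m _ m0 mK Xm)).
have -> (b c : R) : q * m%:R + (q * (K - m)%:R + b + c) = q * K%:R + b + c.
  by rewrite natrB // mulrBr; ring.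
rewrite lerD2l ler_nat leq_mul2l.
by rewrite -[in X in (_ <= X)%N](subnKC mK) visitsD leq_addl orbT.
Qed.

End Visits.

(** * Ergodic theorems from a zero-one law *)

Section Ergodic.
Context d (T : measurableType d) (R : realType) (P : probability T R).
Variable f : T -> T.
Hypotheses (mf : measurable_fun setT f)
  (Pf : forall A, measurable A -> P (f @^-1` A) = P A)
  (zero_one : forall A, measurable A -> f @^-1` A `<=` A -> P A = 0%E \/ P A = 1%E).
Implicit Types (A E : set T) (X : nat -> T -> nat) (q : R).

Lemma measurable_iter n : measurable_fun setT (iter n f).
Proof.
elim: n => [|n IHn]; first exact: measurable_id.
by apply: (@measurableT_comp _ _ _ _ _ _ f _ (iter n f)).
Qed.

Lemma measurable_iter_preimage n A : measurable A -> measurable (iter n f @^-1` A).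
Proof. by move=> mA; rewrite -[X in measurable X]setTI; exact: measurable_iter. Qed.

Lemma iter_preserving n A : measurable A -> P (iter n f @^-1` A) = P A.
Proof.
move=> mA; elim: n => // n <-.
have -> : iter n.+1 f @^-1` A = f @^-1` (iter n f @^-1` A).
  by rewrite /preimage; apply/seteqP; split => w /=; rewrite -iterSr.
exact/Pf/measurable_iter_preimage.
Qed.

Lemma measurable_visits E n : measurable E -> measurable_fun setT (visits f E n).
Proof.
move=> mE; elim: n => [|n IHn].
  by rewrite (_ : visits f E 0 = cst 0%N) //; apply/funext => w; rewrite visits0.
have -> : visits f E n.+1 = fun w => (visits f E n w + (iter n f w \in E))%N.
  by apply/funext => w; rewrite /visits big_ord_recr.
apply: measurable_fun_addn => // _ Y _; rewrite setTI.
rewrite (_ : _ @^-1` Y = (iter n f @^-1` E `&` [set _ | Y 1%N]) `|`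
    (~` (iter n f @^-1` E) `&` [set _ | Y 0%N])).
  have mI := measurable_iter_preimage n mE.
  have mc (b : Prop) : measurable [set _ : T | b].
    by have [y|y] := pselect b; [rewrite (_ : [set _ | _] = setT)|
      rewrite (_ : [set _ | _] = set0)] => //; apply/seteqP; split.
  by apply: measurableU; apply: measurableI => //; exact: measurableC.
apply/seteqP; split=> w /=.
  by have [e|e] := pselect (E (iter n f w)); [rewrite mem_set|rewrite memNset]; auto.
by case=> -[e]; [rewrite mem_set|rewrite memNset].
Qed.

Lemma measurable_natr X n : measurable_fun setT (X n) ->
  measurable_fun setT (fun w => ((X n w)%:R)%:E : \bar R).
Proof.
move=> mX; apply/measurable_EFinP.
exact: (@measurableT_comp _ _ _ _ _ _ (fun k : nat => k%:R : R) _ (X n)).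
Qed.

(** By invariance each of the [n] times contributes [P E]. *)
Lemma integral_visits E n : measurable E ->
  (\int[P]_w ((visits f E n w)%:R)%:E = n%:R%:E * P E)%E.
Proof.
move=> mE; elim: n => [|n IHn].
  by under eq_integral do rewrite visits0; rewrite integral0 mul0e.
have mI := measurable_iter_preimage n mE.
transitivity (\int[P]_w (((visits f E n w)%:R)%:E + (\1_(iter n f @^-1` E) w)%:E))%E.
  apply: eq_integral => w _; rewrite -EFinD /visits big_ord_recr /= natrD indicE.
  by congr (_ + _)%:E; congr (_%:R); congr nat_of_bool; apply/idP/idP; rewrite !inE.
rewrite ge0_integralD //; last 2 first.
- exact/measurable_natr/measurable_visits.
- exact/measurable_EFinP/measurable_indic.
rewrite IHn integral_indic // setIT [X in (_ + X)%E](iter_preserving n mE).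
rewrite -natr1 EFinD ge0_muleDl ?mul1e //.
Qed.

(* The slack j makes this set contain its preimage under f. *)
Definition low X q : set T := [set w | exists j : nat, forall M,
  exists2 n, (M <= n)%N & (X n w)%:R <= q * n%:R + j%:R].

Lemma measurable_preimageT (g : T -> nat) (D : set nat) :
  measurable_fun setT g -> measurable (g @^-1` D).
Proof. by move=> mg; rewrite -[X in measurable X]setTI; exact: mg. Qed.

Lemma measurable_low X q : (forall n, measurable_fun setT (X n)) ->
  measurable (low X q).
Proof.
move=> mX; rewrite (_ : low X q = \bigcup_j \bigcap_M \bigcup_(n in [set n | (M <= n)%N])
    (X n @^-1` [set k | k%:R <= q * n%:R + j%:R])).
  apply: bigcupT_measurable => j; apply: bigcapT_measurable => M.
  by apply: bigcup_measurable => n _; exact: measurable_preimageT.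
apply/seteqP; split=> w /=.
  by case=> j h; exists j => // M _; have [n Mn Xn] := h M; exists n.
by case=> j _ h; exists j => M; have [n Mn Xn] := h M I; exists n.
Qed.

(** One further step at the start costs at most [B], which the slack absorbs. *)
Lemma low_preimage X B q : 0 <= q -> subadditive_cocycle f X -> (forall w, (X 1%N w <= B)%N) ->
  f @^-1` low X q `<=` low X q.
Proof.
move=> q0 Xsub X1 w [j h]; exists (B + j)%N => M.
have [n Mn Xn] := h M; exists n.+1; first exact: leqW.
have := leq_trans (Xsub 1%N n w) (leq_add (X1 w) (leqnn _)).
rewrite -(ler_nat R) natrD => /le_trans; apply.
by rewrite natrD -natr1 mulrDr mulr1 /=; move: Xn => /=; lra.
Qed.

(** The exceptional set for [subadditive_cover]: outside it some block of length at most [M] has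
    slope at most [q]. *)
Definition steep X q M : set T :=
  [set w | forall n, (0 < n <= M)%N -> q * n%:R < (X n w)%:R].

Lemma measurable_steep X q M : (forall n, measurable_fun setT (X n)) ->
  measurable (steep X q M).
Proof.
move=> mX; rewrite (_ : steep X q M = \bigcap_(n in [set n | (0 < n <= M)%N])
    (X n @^-1` [set k | q * n%:R < k%:R])); last by apply/seteqP; split.
by apply: bigcap_measurableType => n _; exact: measurable_preimageT.
Qed.

(** The sets [steep X q' M] decrease in [M] and their intersection misses [low X q], hence is null;
    continuity from above concludes. *)
Lemma steep_small X q q' (eps : R) : (forall n, measurable_fun setT (X n)) ->
  q < q' -> P (low X q) = 1%E -> 0 < eps ->
  exists M, (P (steep X q' M) < eps%:E)%E.
Proof.
move=> mX qq' P1 e0.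
have cap : \bigcap_M steep X q' M `<=` ~` low X q.
  (* Past [j / (q' - q)] the slack is beaten: [q * n + j <= q' * n]. *)
  move=> w ws [j h]; have [n Mn Xn] := h (Num.truncn (j%:R / (q' - q))).+1.
  have n0 : (0 < n)%N by lia.
  have /= := ws n I n; rewrite n0 leqnn => /(_ isT); apply/negP; rewrite -leNgt.
  apply: (le_trans Xn); rewrite -lerBrDl -mulrBl mulrC -ler_pdivrMr ?subr_gt0 //.
  by rewrite ltW // (lt_le_trans (truncnS_gt _)) // ler_nat.
have mS M : measurable (steep X q' M) by exact: measurable_steep.
have mcap : measurable (\bigcap_M steep X q' M) by exact: bigcapT_measurable.
have nlow0 : P (~` low X q) = 0%E.
  by rewrite probability_setC ?P1 ?subee //; exact: measurable_low.
have cap0 : P (\bigcap_M steep X q' M) = 0%E.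
  exact: subset_measure0 mcap (measurableC (measurable_low q mX)) cap nlow0.
have cv : P \o steep X q' @ \oo --> P (\bigcap_M steep X q' M).
  apply: nonincreasing_cvg_mu => //.
    by rewrite (le_lt_trans (probability_le1 _ _)) ?ltry.
  apply/nonincreasing_seqP => M; apply/subsetPset => w h n /andP[n0 nM].
  by apply: h; rewrite n0 leqW.
rewrite cap0 in cv.
have [M _ hM] : \forall M \near \oo, (P (steep X q' M) < eps%:E)%E.
  have : ereal_nbhs 0%E (fun u : \bar R => u < eps%:E)%E.
    by apply: open_ereal_lt'; rewrite lte_fin.
  by move/cv.
by exists M; apply: hM => /=.
Qed.

(** Outside [low], the slack [j = 0] fails, so slopes at most [q] stop occurring from some time
    on. *)
Lemma ae_above X q : (forall n, measurable_fun setT (X n)) -> P (low X q) = 0%E ->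
  {ae P, forall w, \forall n \near \oo, q * n%:R < (X n w)%:R}.
Proof.
move=> mX low0; exists (low X q); split=> //; first exact: measurable_low.
move=> w /=; apply: contra_notP => nlow.
have /existsNP[M hM] : ~ forall M, exists2 n, (M <= n)%N & (X n w)%:R <= q * n%:R.
  move=> h; apply: nlow; exists 0%N => M.
  by have [n Mn Xn] := h M; exists n; rewrite ?addr0.
exists M => // n /= Mn; rewrite ltNge; apply/negP => Xn; apply: hM.
by exists n.
Qed.

Lemma visitsC E n w : (visits f (~` E) n w + visits f E n w = n)%N.
Proof.
rewrite -big_split /= (eq_bigr (fun=> 1%N)) ?sum1_card ?card_ord // => i _.
by rewrite in_setC; case: (_ \in _).
Qed.

Lemma visits_subadditive E : subadditive_cocycle f (visits f E).
Proof. by move=> n m w; rewrite visitsD. Qed.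

Lemma visits1 E w : (visits f E 1 w <= 1)%N.
Proof. by rewrite /visits big_ord1 leq_b1. Qed.

(** The lower half of the ergodic theorem for an indicator. If low slopes had probability 1, the
    covering would bound the visits to [E] pointwise, up to visits to a set of small probability;
    integration then contradicts the choice of [q] below [P E]. *)
Lemma visits_frequency E q : measurable E -> (q%:E < P E)%E ->
  {ae P, forall w, \forall n \near \oo, q * n%:R < (visits f E n w)%:R}.
Proof.
move=> mE; have [q0|q0] := ltP q 0.
  move=> _; apply: aeW => w; exists 1%N => // n /= n1.
  by rewrite (@lt_le_trans _ _ 0) // nmulr_rlt0 // ltr0n.
have PE : P E = (fine (P E))%:E by rewrite fineK // fin_num_measure.
rewrite PE lte_fin; set p := fine (P E) => qp.
have mV n : measurable_fun setT (visits f E n) by exact: measurable_visits.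
have [|low1] := zero_one (measurable_low q mV)
  (low_preimage q0 (@visits_subadditive E) (visits1 E)); first exact: ae_above.
pose q' := (q + p) / 2; pose eps := (p - q') / 2.
have qq' : q < q' by rewrite /q'; lra.
have eps0 : 0 < eps by rewrite /eps /q'; lra.
have [M PM] := steep_small mV qq' low1 eps0.
set D := steep _ _ _ in PM; have mD : measurable D by exact: measurable_steep.
have PD : P D = (fine (P D))%:E by rewrite fineK // fin_num_measure.
rewrite PD lte_fin in PM.
have q'0 : 0 <= q' by rewrite /q'; lra.
have cover w K : (visits f E K w)%:R <= q' * K%:R + M%:R + (visits f D K w)%:R.
  have := @subadditive_cover _ f R (visits f E) 1 M q' D _ _ _ q'0 _ K w.
  rewrite !mul1n; apply; [exact: visits0|exact: visits_subadditive|exact: visits1|].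
  move=> {}w /existsNP[n /not_implyP[nM /negP]]; rewrite -leNgt => h.
  by exists n.
have bound K : K%:R * p <= q' * K%:R + M%:R + K%:R * fine (P D).
  rewrite -lee_fin EFinM -PE -integral_visits //.
  have a0 : 0 <= q' * K%:R + M%:R by rewrite addr_ge0 // mulr_ge0.
  rewrite [leRHS]EFinD [in leRHS]EFinM -PD -[in leRHS]integral_visits //.
  rewrite [X in (X + _)%E](_ : _ = \int[P]_w cst (q' * K%:R + M%:R)%:E w)%E; last first.
    by rewrite integral_cst // [X in (_ * X)%E]probability_setT mule1.
  rewrite -ge0_integralD //; last exact/measurable_natr/measurable_visits.
  apply: ge0_le_integral => //.
  - exact/measurable_natr/measurable_visits.
  - by apply: emeasurable_funD => //; exact/measurable_natr/measurable_visits.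
  - by move=> w _; rewrite -EFinD lee_fin.
(* Large enough for [M < K * eps]; since [q' + 2 * eps = p], the bound then reads
   [K * p < K * p]. *)
pose K := (Num.truncn (M%:R / eps)).+1.
have := bound K; have : M%:R < K%:R * eps.
  by rewrite -ltr_pdivrMr // truncnS_gt.
have : K%:R * fine (P D) <= K%:R * eps by rewrite ler_wpM2l // ltW.
rewrite /eps; nra.
Qed.

(** The limit is the infimum of the slopes [q >= 0] for which [low X q] has probability 1. Below it
    the zero-one law makes [low] null; above it the covering applies, its exceptional steps being
    rare by [visits_frequency]. *)
Lemma kingman X B : (forall n, measurable_fun setT (X n)) ->
  X 0%N =1 (fun=> 0%N) -> subadditive_cocycle f X -> (forall w, (X 1%N w <= B)%N) ->
  exists c : R, {ae P, forall w, (X n w)%:R / n%:R @[n --> \oo] --> c}.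
Proof.
move=> mX X0 Xsub X1.
pose S := [set q : R | 0 <= q /\ P (low X q) = 1%E].
have SB : S B%:R.
  split=> //; rewrite (_ : low X B%:R = setT) ?probability_setT //.
  apply/seteqP; split=> // w _; exists 0%N => M; exists M => //.
  by rewrite addr0 -natrM ler_nat (subadditive_linear X0 Xsub X1).
have lbS : has_lbound S by exists 0 => q [].
exists (inf S); set c := inf S.
have lower eps : 0 < eps ->
    {ae P, forall w, \forall n \near \oo, (c - eps) * n%:R <= (X n w)%:R}.
  move=> e0; have [n0|c0] := ltP (c - eps) 0.
    apply: aeW => w; exists 0%N => // n _ /=.
    by rewrite (@le_trans _ _ 0) // nmulr_rle0.
  have [|low1] := zero_one (measurable_low (c - eps) mX) (low_preimage c0 Xsub X1).
    move/(ae_above mX); apply: filterS => w; apply: filterS => n; exact: ltW.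
  have : c <= c - eps by apply: ge_inf.
  lra.
have upper eps : 0 < eps ->
    {ae P, forall w, \forall n \near \oo, (X n w)%:R <= (c + eps) * n%:R}.
  move=> e0; have [s [s0 low1] sc] : exists2 s, S s & s < c + eps / 4.
    have e4 : 0 < eps / 4 by lra.
    by apply: (inf_adherent e4); split=> //; exists B%:R.
  (* At this density, exceptional steps costing [B] each add at most [eps / 4] to the slope. *)
  pose eta := eps / (4 * B.+1%:R).
  have eta0 : 0 < eta by rewrite divr_gt0 // mulr_gt0.
  have [M PM] := steep_small mX sc low1 eta0.
  set D := steep _ _ _ in PM; have mD : measurable D by exact: measurable_steep.
  have PD : ((1 - eta)%:E < P (~` D))%E.
    have PDE : P D = (fine (P D))%:E by rewrite fineK // fin_num_measure.
    move: PM; rewrite probability_setC // PDE -EFinB !lte_fin; lra.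
  (* [visits_frequency] bounds only from below, so it is applied to the complement of [D]. *)
  have := visits_frequency (measurableC mD) PD; apply: filterS => w wD.
  have c0 : 0 <= c + eps / 4 by lra.
  near=> n.
  apply: (le_trans (@subadditive_cover _ f R X B M _ D X0 Xsub X1 c0 _ n w)).
    move=> v /existsNP[m /not_implyP[mM /negP]]; rewrite -leNgt => h.
    by exists m.
  have BM : (B * M)%:R <= eps / 4 * n%:R.
    rewrite mulrC -ler_pdivrMr ?divr_gt0 //; near: n.
    exact: nbhs_infty_ger.
  have Vn : (visits f D n w)%:R <= eta * n%:R.
    have := visitsC D n w; move/(congr1 (fun k => k%:R : R)); rewrite natrD.
    have : (1 - eta) * n%:R < (visits f (~` D) n w)%:R by near: n.
    lra.
  have BV : (B * visits f D n w)%:R <= eps / 4 * n%:R.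
    rewrite natrM (@le_trans _ _ (B.+1%:R * (eta * n%:R))) //.
      by apply: ler_pM => //; rewrite ler_nat.
    have : B.+1%:R != 0 :> R by rewrite pnatr_eq0.
    rewrite /eta; set b := B.+1%:R => b0.
    suff -> : b * (eps / (4 * b) * n%:R) = eps / 4 * n%:R by [].
    by field.
  have n0 : 0 <= eps / 4 * n%:R by rewrite mulr_ge0 // divr_ge0 // ltW.
  rewrite (_ : (c + eps) * n%:R = (c + eps / 4) * n%:R + eps / 4 * n%:R +
    eps / 4 * n%:R + eps / 4 * n%:R); last by field.
  by rewrite -[leLHS]addr0 !lerD.
(* The errors [1 / k.+1] are countably many, so that one null set serves them all. *)
have /ae_foralln : forall k, {ae P, forall w, \forall n \near \oo,
    (c - k.+1%:R^-1) * n%:R <= (X n w)%:R <= (c + k.+1%:R^-1) * n%:R}.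
  move=> k; have e0 : 0 < k.+1%:R^-1 :> R by rewrite invr_gt0.
  near=> w; have lw : \forall n \near \oo, (c - k.+1%:R^-1) * n%:R <= (X n w)%:R.
    by near: w; exact: lower.
  have uw : \forall n \near \oo, (X n w)%:R <= (c + k.+1%:R^-1) * n%:R.
    by near: w; exact: upper.
  by near=> n; apply/andP; split; near: n.
apply: filterS => w hw; apply/cvgrPdist_le => eps e0.
pose k := Num.truncn eps^-1.
have ke : k.+1%:R^-1 <= eps.
  by rewrite invf_ple ?posrE // ltW // truncnS_gt.
have hk := hw k; near=> n.
have n0 : 0 < n%:R :> R by rewrite ltr0n; near: n; exact: nbhs_infty_gt.
have /andP[h1 h2] : (c - k.+1%:R^-1) * n%:R <= (X n w)%:R <= (c + k.+1%:R^-1) * n%:R.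
  by near: n.
apply: le_trans ke; rewrite distrC ler_distl ler_pdivlMr // ler_pdivrMr //.
by rewrite h1 h2.
Unshelve. all: by end_near.
Qed.

End Ergodic.

(** * Stationarity and ergodicity of the chain *)

Lemma fsbig_finTypeE (V : nmodType) (I : finType) (F : I -> V) :
  \sum_(i \in [set: I]) F i = \sum_i F i.
Proof.
rewrite fsbig_finite //=; apply: perm_big; apply: uniq_perm => [||x].
- exact: finmap.fset_uniq.
- exact: index_enum_uniq.
- rewrite mem_index_enum in_fset_set; [exact: mem_set|exact: finite_finset].
Qed.

(** * In-degrees of the transition graph *)

Section NielsenDegree.
Variable r : nat.
Local Notation S := (nielsen r).

(** For [t = [x |-> yx]] the predecessors have either source [x] and multiplier outside
    [{x, x^-1, y^-1}], or source [y] and multiplier outside [{y, y^-1, x^-1}]. *)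
Lemma card_admissible_pred (t : S) : #|[set s | admissible s t]%SET| = (4 * r - 6)%N.
Proof.
pose x := nielsen_src t; pose y := nielsen_mul t.
have /andP[/= yx yxV] := nielsen_okP t; rewrite -/x -/y in yx yxV.
pose C (u v : letter r) : {set letter r} := (~: [set u; linv u; linv v])%SET.
have CE u v z : (z \in C u v) = [&& z != u, z != linv u & z != linv v].
  by rewrite !inE !negb_or andbA.
have cC u v : v != u -> v != linv u -> #|C u v| = (2 * r - 3)%N.
  move=> vu vuV; have := cardsC [set u; linv u; linv v]%SET.
  rewrite -/(C u v) card_letter => <-.
  rewrite -finset.setUA cardsU1 cardsU1 cards1 !inE linv_eq negb_or.
  rewrite -[u == linv v]linv_eq linvK.
  by rewrite ![_ == v]eq_sym vu vuV eq_sym linv_neq /= addKn.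
have xyV : x != linv y by rewrite -linv_eq linvK eq_sym.
have -> : #|[set s | admissible s t]%SET| =
    #|(pair x @: C x y :|: pair y @: C y x)%SET|.
  rewrite -(card_imset _ val_inj); apply: eq_card => p.
  apply/imsetP/setUP => [[s]|].
    rewrite inE /admissible -/x -/y => st ->.
    have /andP[/= ts tsV] := nielsen_okP s; move: st ts tsV.
    rewrite [val s]surjective_pairing -/(nielsen_src s) -/(nielsen_mul s).
    case/orP=> /andP[/eqP <- ne] ts tsV; [left|right];
      apply: imset_f; rewrite CE ts tsV /=.
      by apply: contra ne => /eqP ->; rewrite linvK.
    by apply: contra ne => /eqP ->; rewrite linvK.
  case=> /imsetP[z]; rewrite CE => /and3P[zx zxV zy] ->.
    have ok : nielsen_ok (x, z) by rewrite /nielsen_ok /= zx zxV.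
    exists (exist _ (x, z) ok) => //; rewrite inE /admissible /= eqxx /=.
    by rewrite -[nielsen_mul t == _]linv_eq linvK eq_sym zy.
  have ok : nielsen_ok (y, z) by rewrite /nielsen_ok /= zx zxV.
  exists (exist _ (y, z) ok) => //; rewrite inE /admissible /= eqxx /=.
  by rewrite -[nielsen_src t == linv _]linv_eq linvK [linv _ == z]eq_sym zy orbT.
rewrite cardsU (_ : (_ :&: _)%SET = finset.set0); last first.
  apply/finset.setP => -[u v]; rewrite !inE; apply/negbTE/negP => /andP[].
  move=> /imsetP[z zC [-> ->]] /imsetP[z' z'C [xy _]].
  by rewrite xy eqxx in yx.
rewrite cards0 subn0 !card_imset ?cC //; first by rewrite addnn -mul2n mulnBr mulnA.
- by rewrite eq_sym.
- by move=> u v [].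
- by move=> u v [].
Qed.

End NielsenDegree.

(** * The shift on trajectories *)

Section Shift.
Context (R : realType) (r : nat) (hr : (2 < r)%N).
Local Notation S := (nielsen r).
Local Notation Om := (trajectories hr).

Definition traj_shift (w : Om) : Om := fun n => w n.+1.

Definition cylinder n (s : nat -> S) : set Om :=
  [set w | forall i, (i <= n)%N -> w i = s i].

Lemma iter_shiftE k (w : Om) i : iter k traj_shift w i = w (k + i)%N.
Proof. by elim: k i => //= k IHk i; rewrite /traj_shift IHk addnS. Qed.

Lemma measurable_coordinate i (B : set S) : measurable [set w : Om | B (w i)].
Proof. by apply: sub_sigma_algebra; exists i, B. Qed.

Lemma measurable_cylinder n s : measurable (cylinder n s).
Proof.
rewrite (_ : cylinder n s = \bigcap_(i in [set i | (i <= n)%N])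
  [set w : Om | [set s i] (w i)]); last by apply/seteqP; split.
by apply: bigcap_measurableType => i _; exact: measurable_coordinate.
Qed.

(** There are finitely many states, so [A] is a finite union of sets that prescribe the first [n]
    coordinates. *)
Lemma measurable_finite_dep n (A : set Om) :
  (forall w w', (forall i, (i < n)%N -> w i = w' i) -> A w -> A w') ->
  measurable A.
Proof.
move=> dep; rewrite (_ : A = \bigcup_(t in [set t : {ffun 'I_n -> S} |
    exists2 w, A w & forall i : 'I_n, w i = t i])
    \bigcap_(i in [set: 'I_n]) [set w | [set t i] (w i)]).
  apply: fin_bigcup_measurable => // t _.
  by apply: fin_bigcap_measurable => // i _; exact: measurable_coordinate.
apply/seteqP; split=> [w Aw|w [t [v Av vt] wt]].
  exists [ffun i : 'I_n => w i]; first by exists w => // i; rewrite ffunE.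
  by move=> i _; rewrite /= ffunE.
apply: dep Av => i ni; have /= := wt (Ordinal ni) I.
by have /= := vt (Ordinal ni) => -> ->.
Qed.

Lemma measurable_traj_shift : measurable_fun setT traj_shift.
Proof.
apply: (@measurability _ _ Om Om setT traj_shift (@coordinate_sets S)); first exact: erefl.
move=> _ [_ [i [B ->]] <-]; rewrite setTI; exact: measurable_coordinate.
Qed.

(** Two cylinders are nested or disjoint, so together with [set0] and [setT] they form a generating
    pi-system. General finite measures are allowed because restrictions and multiples of [P] are
    compared below. *)
Lemma cylinder_measure_unique (m1 m2 : {measure set Om -> \bar R}) :
  (forall n s, m1 (cylinder n s) = m2 (cylinder n s)) ->
  m1 setT = m2 setT -> (m1 setT < +oo)%E ->
  forall A, measurable A -> m1 A = m2 A.
Proof.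
move=> m12 m12T m1T.
pose G := [set A : set Om | A = setT \/ A = set0 \/ exists n s, A = cylinder n s].
have mG A : G A -> measurable A.
  by move=> [->|[->|[n [s ->]]]] //; exact: measurable_cylinder.
apply: (measure_unique G (fun=> setT)) => //.
- apply/seteqP; split; apply: smallest_sub; try exact: smallest_sigma_algebra.
  + move=> _ [i [B ->]].
    pose T : measurableType _ := g_sigma_algebraType G.
    rewrite (_ : [set w : Om | B (w i)] =
        \bigcup_(t in [set t : {ffun 'I_i.+1 -> S} | B (t ord_max)])
          cylinder i (fun j => t (inord j))).
      apply: (@fin_bigcup_measurable _ T) => // t _.
      by apply: sub_sigma_algebra; right; right; exists i, (fun j => t (inord j)).
    apply/seteqP; split=> [w Bw|w [t Bt /(_ i (leqnn _)) wi]].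
      exists [ffun j : 'I_i.+1 => w j]; first by rewrite /= ffunE.
      by move=> j ji; rewrite ffunE inordK.
    rewrite /= wi (_ : inord i = ord_max) //.
    by apply: val_inj; rewrite /= inordK.
  + by move=> A /mG.
- suff H n s m t : (n <= m)%N -> G (cylinder n s `&` cylinder m t).
    move=> A B [->|[->|[n [s ->]]]]; rewrite ?setTI ?set0I //; first by right; left.
    move=> [->|[->|[m [t ->]]]]; rewrite ?setIT ?setI0.
    + by right; right; exists n, s.
    + by right; left.
    by have [/H//|/ltnW/H] := leqP n m; rewrite setIC.
  move=> nm; have [st|st] := pselect (forall i, (i <= n)%N -> s i = t i).
    right; right; exists m, t; apply/seteqP; split=> [w []//|w h]; split=> // i ni.
    by rewrite h ?st // (leq_trans ni).
  right; left; apply/seteqP; split=> // w [hs ht]; apply: st => i ni.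
  by rewrite -hs ?ht // (leq_trans ni).
- by move=> _; left.
- by rewrite bigcup_const.
- by move=> A [->|[->|[n [s ->]]]]; rewrite ?measure0.
Qed.

Variable P : probability Om R.
Hypothesis chainP : is_chain_law P.

Lemma cylinderE n s :
  P (cylinder n s) = (chain_init R (s 0%N) * \prod_(i < n) chain_trans R (s i) (s i.+1))%:E.
Proof. exact: chainP. Qed.

Lemma probability_split i (A : set Om) : measurable A ->
  P A = (\sum_(a : S) P (A `&` [set w | w i = a]))%E.
Proof.
move=> mA; rewrite -fsbig_finTypeE -measure_fin_bigcup.
- congr (P _); apply/seteqP; split=> [w Aw|w [a _ []]//].
  by exists (w i).
- exact: finite_finset.
- apply/trivIsetP => a b _ _ ab; apply/seteqP; split=> // w [[_ /= wa] [_ /= wb]].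
  by move: ab; rewrite -wa -wb eqxx.
- by move=> a _; apply: measurableI => //; exact: (measurable_coordinate i [set a]).
Qed.

Lemma degree_neq0 : (4 * r - 6)%:R != 0 :> R.
Proof.
by rewrite pnatr_eq0 -lt0n subn_gt0 (@leq_trans (4 * 2)) // leq_mul2l ltnW.
Qed.

Lemma sum_chain_trans (a : S) : \sum_b chain_trans R a b = 1.
Proof.
rewrite /chain_trans -big_mkcond /= sumr_const.
rewrite (_ : #|_| = #|[set s | admissible a s]%SET|); last first.
  by apply: eq_card => s; rewrite !inE.
by rewrite card_admissible -[LHS]mulr_natr mulVf // degree_neq0.
Qed.

Lemma sum_chain_trans_pred (b : S) : \sum_a chain_trans R a b = 1.
Proof.
rewrite /chain_trans -big_mkcond /= sumr_const.
rewrite (_ : #|_| = #|[set s | admissible s b]%SET|); last first.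
  by apply: eq_card => s; rewrite !inE.
by rewrite card_admissible_pred -[LHS]mulr_natr mulVf // degree_neq0.
Qed.

(** On a cylinder, sum over the state that precedes it: the transition probabilities into a fixed
    state add up to 1. *)
Lemma shift_preserving (A : set Om) : measurable A -> P (traj_shift @^-1` A) = P A.
Proof.
move=> mA; pose sh : {mfun Om >-> Om} := MeasurableFun.Pack (MeasurableFun.Class
  (isMeasurableFun.Build _ _ _ _ _ measurable_traj_shift)).
apply: (@cylinder_measure_unique (pushforward P sh) P) => //.
- move=> n s; rewrite [RHS]cylinderE /pushforward /=.
  rewrite [LHS](probability_split 0); last first.
    by rewrite -[X in measurable X]setTI; apply: measurable_traj_shift => //; exact: measurable_cylinder.
  pose s' a i := if i is j.+1 then s j else a.
  rewrite (eq_bigr (fun a => P (cylinder n.+1 (s' a)))); last first.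
    move=> a _; congr (P _); apply/seteqP; split=> [w [h w0] [|i]//|w h].
      by move=> ni; exact: h.
    by split=> [i ni|]; [exact: (h i.+1)|exact: (h 0%N)].
  under eq_bigr do rewrite cylinderE big_ord_recl /=.
  rewrite sumEFin; congr EFin; rewrite /chain_init -mulr_sumr; congr (_ * _).
  by rewrite -mulr_suml sum_chain_trans_pred mul1r.
- by rewrite [X in (X < _)%E](_ : _ = 1%E) ?ltry //; exact: probability_setT.
Qed.

Local Notation N := (#|{: S}|%:R : R).

Lemma card_nielsen_gt0 : 0 < N.
Proof. by rewrite ltr0n; apply/card_gt0P; have [s] := nielsen_inhabited hr; exists s. Qed.

Lemma probability_start a : P [set w | w 0%N = a] = (N^-1)%:E.
Proof.
rewrite (_ : [set w | _] = cylinder 0 (fun=> a)).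
  by rewrite cylinderE big_ord0 mulr1.
by apply/seteqP; split=> [w /= wa [|]//|w /(_ 0%N isT)].
Qed.

(** The Markov property at time [k]. The factor [N] turns the last probability into a conditional
    one, every start having probability [1 / N]. Both sides are finite measures in [A], so cylinders
    suffice. *)
Lemma markov k s (A : set Om) : measurable A ->
  P (cylinder k s `&` iter k traj_shift @^-1` A) =
  ((N * fine (P (cylinder k s)))%:E * P (A `&` [set w | w 0%N = s k]))%E.
Proof.
move=> mA; have mc := measurable_cylinder k s.
have m0 : measurable [set w : Om | [set s k] (w 0%N)] by exact: measurable_coordinate.
have mi : measurable_fun setT (iter k (@traj_shift)).
  exact: (measurable_iter measurable_traj_shift k).
pose sh : {mfun Om >-> Om} := MeasurableFun.Pack (MeasurableFun.Class
  (isMeasurableFun.Build _ _ _ _ _ mi)).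
have a0 : 0 <= N * fine (P (cylinder k s)) by rewrite mulr_ge0 // fine_ge0.
have key n t : P (cylinder k s `&` iter k traj_shift @^-1` cylinder n t) =
    ((N * fine (P (cylinder k s)))%:E * P (cylinder n t `&` [set w | w 0%N = s k]))%E.
  have [tk|tk] := eqVneq (t 0%N) (s k); last first.
    rewrite (_ : cylinder k s `&` _ = set0); last first.
      apply/seteqP; split=> // w [h1 /(_ 0%N isT)]; rewrite iter_shiftE addn0 h1 //.
      by move=> e; rewrite e eqxx in tk.
    rewrite (_ : cylinder n t `&` _ = set0); first by rewrite !measure0 mule0.
    by apply/seteqP; split=> // w [/(_ 0%N isT) /= -> e]; rewrite e eqxx in tk.
  rewrite (_ : cylinder n t `&` _ = cylinder n t); last first.
    by apply/seteqP; split=> [w []//|w h]; split=> //=; rewrite h.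
  (* The two words glued along the state at time [k], which they share. *)
  pose st i := if (i <= k)%N then s i else t (i - k)%N.
  rewrite (_ : cylinder k s `&` _ = cylinder (k + n) st); last first.
    apply/seteqP; split=> [w [h1 h2] i|w h].
      rewrite /st; case: (leqP i k) => [ik _|ki ikn]; first exact: h1.
      have ikn' : (i - k <= n)%N by rewrite leq_subLR.
      by rewrite -(h2 _ ikn') iter_shiftE subnKC // ltnW.
    split=> i ii; first by rewrite h /st ?ii // (leq_trans ii) // leq_addr.
    rewrite iter_shiftE h ?leq_add2l // /st; case: leqP => [|_]; last by rewrite addKn.
    by rewrite -[X in (_ <= X)%N]addn0 leq_add2l leqn0 => /eqP ->; rewrite addn0 tk.
  rewrite !cylinderE /= -EFinM big_split_ord /= /chain_init /st /=.
  rewrite (eq_bigr (fun i : 'I_k => chain_trans R (s i) (s i.+1))); last first.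
    by move=> i _; rewrite ltnW ltn_ord.
  rewrite [X in _ * (_ * X)](eq_bigr (fun i : 'I_n => chain_trans R (t i) (t i.+1))).
    by congr EFin; rewrite -!mulrA mulVKf ?gt_eqF ?card_nielsen_gt0 // mulrCA.
  move=> i _; rewrite [(k + i < k)%N]ltnNge leq_addr /= subSn ?leq_addr // addKn.
  case: leqP => // ki; have -> : nat_of_ord i = 0%N by lia.
  by rewrite addn0 tk.
have PTc : P ([set: Om] `&` cylinder k s) = P (cylinder k s) by rewrite setTI.
have E2 : ((N * fine (P (cylinder k s)))%:E * P ([set: Om] `&` [set w | w 0%N = s k]))%E
    = P (cylinder k s).
  rewrite setTI probability_start -EFinM.
  by rewrite mulrAC mulfV ?mul1r ?fineK ?fin_num_measure // gt_eqF // card_nielsen_gt0.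
rewrite setIC; apply: (@cylinder_measure_unique
  (pushforward (mrestr P mc) sh) (mscale (NngNum a0) (mrestr P m0))) => //.
- by move=> n t; rewrite [LHS]/(P (_ `&` _)) setIC; exact: key.
- exact: (etrans PTc (esym E2)).
- rewrite [X in (X < _)%E](_ : _ = P (cylinder k s)); last exact: PTc.
  by rewrite (le_lt_trans (probability_le1 _ _)) ?ltry.
Qed.

(** By stationarity [A] agrees with its preimages up to null sets, which makes the conditional
    probability of [A] harmonic in the starting state, hence constant. Then [A] is independent of
    every cylinder, and so of itself. *)
Lemma zero_one_shift (A : set Om) : (forall s t : S, connect (@admissible r) s t) ->
  measurable A -> traj_shift @^-1` A `<=` A -> P A = 0%E \/ P A = 1%E.
Proof.
move=> conn mA sA.
have N0 := card_nielsen_gt0.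
have fE (B : set Om) : measurable B -> P B = (fine (P B))%:E.
  by move=> mB; rewrite fineK // fin_num_measure.
have mst k : measurable (iter k traj_shift @^-1` A).
  exact: (measurable_iter_preimage measurable_traj_shift).
have stA k : iter k traj_shift @^-1` A `<=` A.
  elim: k => // k IHk w /= h; apply: IHk; apply: sA; by rewrite /preimage /= -iterS.
have Pst k : P (iter k traj_shift @^-1` A) = P A.
  exact: (iter_preserving measurable_traj_shift shift_preserving).
have inv k (D : set Om) : measurable D ->
    P (D `&` iter k traj_shift @^-1` A) = P (D `&` A).
  move=> mD; apply/eqP; rewrite eq_le; apply/andP; split.
    apply: le_measure; rewrite ?inE; [exact: measurableI|exact: measurableI|].
    by apply: setIS.
  have mE : measurable (A `\` iter k traj_shift @^-1` A) by exact: measurableD.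
  (* The preimage is contained in [A] and has the same measure. *)
  have E0 : P (A `\` iter k traj_shift @^-1` A) = 0%E.
    rewrite measureD //; last by rewrite (le_lt_trans (probability_le1 _ _)) ?ltry.
    by rewrite setIidr // [X in (_ - X)%E](Pst k) subee // fin_num_measure.
  apply: (@le_trans _ _ (P ((D `&` iter k traj_shift @^-1` A) `|` (A `\` iter k traj_shift @^-1` A)))).
    apply: le_measure; rewrite ?inE; [exact: measurableI| |].
      by apply: measurableU => //; exact: measurableI.
    by move=> w [Dw Aw]; have [h|h] := pselect ((iter k traj_shift @^-1` A) w); [left|right].
  apply: (le_trans (measureU2 _ _ _)) => //; first exact: measurableI.
  by rewrite [X in (_ + X)%E]E0 adde0.
(* The probability of [A] given the starting state [a]. *)
pose h a := N * fine (P (A `&` [set w | w 0%N = a])).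
have mA0 a : measurable (A `&` [set w : Om | w 0%N = a]).
  by apply: measurableI => //; exact: (measurable_coordinate 0 [set a]).
have cyl k s : P (cylinder k s `&` A) = (fine (P (cylinder k s)) * h (s k))%:E.
  rewrite -(inv k) ?markov //; last exact: measurable_cylinder.
  by rewrite [X in (_ * X)%E](fE _ (mA0 _)) -EFinM /h [N * _]mulrC -!mulrA.
have harm a : h a = \sum_b chain_trans R a b * h b.
  rewrite /h setIC (_ : [set w | w 0%N = a] = cylinder 0 (fun=> a)); last first.
    by apply/seteqP; split=> [w /= wa [|]//|w /(_ 0%N isT)].
  rewrite (probability_split 1); last first.
    by apply: measurableI => //; exact: measurable_cylinder.
  pose s b i := if i is 0%N then a else b.
  rewrite (eq_bigr (fun b => (N^-1 * chain_trans R a b * h b)%:E)); last first.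
    move=> b _; have := cyl 1%N (s b); rewrite cylinderE /= big_ord1 /= => <-.
    congr (P _); apply/seteqP; split=> [w [[w0 Aw] /= w1]|w [h1 Aw]].
      by split=> // -[_|[_|//]] //=; exact: w0.
    by split; [split=> //; move=> [|//] _; exact: (h1 0%N)|exact: (h1 1%N)].
  rewrite sumEFin /= mulr_sumr; apply: eq_bigr => b _.
  by rewrite -mulrA mulVKf // gt_eqF.
(* Maximum principle: where [h] is maximal, an average of nonnegative defects vanishes, so [h] is
   maximal at every successor; irreducibility spreads this to all states. *)
have hconst a b : h a = h b.
  have [m _ hm'] := @Order.TotalTheory.arg_maxP _ _ S a xpredT h isT.
  have hm c : h c <= h m by exact: hm'.
  have step c c' : h c = h m -> admissible c c' -> h c' = h m.
    move=> hc cc'; apply/eqP; rewrite eq_le hm //= leNgt; apply/negP => lt.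
    have : \sum_d chain_trans R c d * (h m - h d) = 0.
      under eq_bigr do rewrite mulrBr.
      by rewrite sumrB -mulr_suml sum_chain_trans mul1r -harm hc subrr.
    move/eqP; rewrite psumr_eq0 => [/allP/(_ c' (mem_index_enum _))|d _].
      rewrite /chain_trans cc' /= mulf_eq0 invr_eq0 (negbTE degree_neq0) /=.
      by rewrite subr_eq0 gt_eqF.
    apply: mulr_ge0; last by rewrite subr_ge0.
    by rewrite /chain_trans; case: ifP; rewrite ?invr_ge0.
  have stepp p : forall c, h c = h m -> path (@admissible r) c p -> h (last c p) = h m.
    elim: p => //= c1 p IHp c hc /andP[cc1 pp].
    by apply: IHp pp; exact: step hc cc1.
  have hmax c : h c = h m by have /connectP[p pp ->] := conn m c; exact: stepp.
  by rewrite !hmax.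
have hA a : h a = fine (P A).
  rewrite (probability_split 0 mA) (eq_bigr (fun b => (N^-1 * h b)%:E)); last first.
    by move=> b _; rewrite /h mulKf ?gt_eqF // -fE.
  rewrite sumEFin /= (eq_bigr (fun=> N^-1 * h a)); last first.
    by move=> b _; rewrite (hconst b a).
  by rewrite sumr_const -[RHS]mulr_natl mulVKf // gt_eqF.
have p0 : 0 <= fine (P A) by rewrite fine_ge0.
have E1 : P ([set: Om] `&` A) = P A by rewrite setTI.
have E2 : ((fine (P A))%:E * P setT)%E = P A by rewrite probability_setT mule1 -fE.
have E3 n s : P (cylinder n s `&` A) = ((fine (P A))%:E * P (cylinder n s))%E.
  by rewrite cyl hA mulrC EFinM -(fE (cylinder n s)) //; exact: measurable_cylinder.
have ind D : measurable D -> P (D `&` A) = ((fine (P A))%:E * P D)%E.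
  move=> mD; apply: (@cylinder_measure_unique (mrestr P mA) (mscale (NngNum p0) P)) => //.
  - exact: (etrans E1 (esym E2)).
  - rewrite [X in (X < _)%E](_ : _ = P A); last exact: E1.
    by rewrite (le_lt_trans (probability_le1 _ _)) ?ltry.
(* Independence of [A] from itself: its probability equals its own square. *)
have := ind A mA; rewrite setIid fE // -EFinM => -[].
have [->|n0] := eqVneq (fine (P A)) 0; first by left.
by move=> e; right; congr EFin; apply: (mulfI n0); rewrite mulr1 -e.
Qed.

End Shift.

(** * Lengths in the free group and its outer automorphism group *)

(** Blocks are nonempty, so neighbours in the flattened word lie in one block or at the junction of
    two consecutive ones. *)
Lemma path_flatten (T : eqType) (e e' : rel T) (f : T -> seq T) :
  (forall a, f a != [::]) -> (forall a, sorted e' (f a)) ->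
  (forall a b, e a b -> e' (last a (f a)) (head b (f b))) ->
  forall p a, path e a p -> path e' (last a (f a)) (flatten [seq f b | b <- p]).
Proof.
move=> f0 fs fe; elim=> //= b p IHp a /andP[ab /IHp].
rewrite cat_path; have := fe _ _ ab; have := fs b.
by case: (f b) (f0 b) => //= c t _ -> ->.
Qed.

Lemma cycle_flatten (T : eqType) (e e' : rel T) (f : T -> seq T) :
  (forall a, f a != [::]) -> (forall a, sorted e' (f a)) ->
  (forall a b, e a b -> e' (last a (f a)) (head b (f b))) ->
  forall u, cycle e u -> cycle e' (flatten [seq f a | a <- u]).
Proof.
move=> f0 fs fe [//|a p] /(path_flatten f0 fs fe).
rewrite map_rcons -cats1 flatten_cat /= cats0.
case: (f a) (f0 a) (fs a) => //= h t _ ht; rewrite rcons_cat -cats1 !cat_path /= ht.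
by case/and3P=> -> ->.
Qed.

Lemma path_flatten_nseq (T : Type) (e : rel T) m a p : cycle e (a :: p) ->
  path e (last a p) (flatten (nseq m (a :: p))).
Proof.
rewrite /= rcons_path => /andP[ap pa]; elim: m => //= m IHm.
by rewrite pa cat_path ap.
Qed.

Section FreeGroupLength.
Variable r : nat.
Local Open Scope group_scope.
Local Notation F := (free_group r).
Implicit Types (u v g : F) (f : autg F).

Definition flen u := size (fg_word u).

Lemma flenM u v : (flen (u * v)%g <= flen u + flen v)%N.
Proof.
rewrite /flen /=; elim: (fg_word u) => //= x w IHw.
case: (foldr _ _ w) IHw => [|y t] //= h; case: ifP => _ /=; lia.
Qed.

Lemma flenV u : flen u^-1 = flen u.
Proof. by rewrite /flen /= /winv size_rev size_map. Qed.

Lemma flen_prod (I : Type) (s : seq I) (E : I -> F) K :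
  (forall i, flen (E i) <= K)%N -> (flen (\prod_(i <- s) E i)%g <= K * size s)%N.
Proof.
move=> EK; elim: s => [|i s IHs]; first by rewrite big_nil.
by rewrite big_cons (leq_trans (flenM _ _)) // mulnS leq_add.
Qed.

(** A Lipschitz constant of [f] for [flen], as [flen_lip] shows. *)
Definition lip f : nat := \max_(x : letter r) flen (f (fg_gen x)).

Lemma flen_lip f u : (flen (f u) <= lip f * flen u)%N.
Proof.
rewrite (fg_hom_lift (autgM f)) /fg_lift; apply: flen_prod => x.
exact: (leq_bigmax x).
Qed.

(** A relation on neighbouring letters: under [cycle] it expresses cyclic reducedness of a word,
    under [sorted] plain reducedness. *)
Definition cyclically_reduced : rel (letter r) := [rel x y | y != linv x].

Lemma fg_word_prod_gen (w : seq (letter r)) :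
  fg_word (\prod_(x <- w) fg_gen x) = foldr (@lmul r) [::] w.
Proof. by elim: w => [|x w IHw]; rewrite ?big_nil // big_cons /= IHw. Qed.

Lemma fg_prod_gen u : u = \prod_(x <- fg_word u) fg_gen x.
Proof. by apply: val_inj; rewrite /= fg_word_prod_gen foldr_reduced //; exact: (valP u). Qed.

(* The length of (g u g^-1)^m = g u^m g^-1 differs from m |u| by a bounded amount. *)
Lemma cyclically_reduced_min u g :
  cycle cyclically_reduced (fg_word u) -> (flen u <= flen (g * u * g^-1)%g)%N.
Proof.
move=> cu.
(* Copies of a cyclically reduced word concatenate without cancellation. *)
have pow m : flen (u ^+ m) = (m * flen u)%N.
  have -> : u ^+ m = \prod_(x <- flatten (nseq m (fg_word u))) fg_gen x.
    elim: m => [|m IHm] /=; first by rewrite expg0 big_nil.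
    by rewrite big_cat /= -fg_prod_gen expgS IHm.
  rewrite /flen fg_word_prod_gen foldr_reduced ?size_flatten /shape.
    by rewrite map_nseq sumn_nseq mulnC.
  case: (fg_word u) cu => [_|a p cp]; first by elim: m.
  exact: path_sorted (path_flatten_nseq m cp).
have conj m : (g * u * g^-1) ^+ m = g * u ^+ m * g^-1.
  elim: m => [|m IHm]; first by rewrite !expg0 mulg1 mulgV.
  by rewrite !expgS IHm !mulgA mulgVK.
have bound m : (m * flen u <= m * flen (g * u * g^-1)%g + flen g + flen g)%N.
  have -> : (m * flen u)%N = flen (g^-1 * (g * u * g^-1) ^+ m * g)%g.
    by rewrite conj !mulgA mulVg mul1g mulgVK pow.
  rewrite (leq_trans (flenM _ _)) // leq_add2r (leq_trans (flenM _ _)) //.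
  rewrite flenV addnC leq_add2r.
  elim: m => [|m IHm]; first by rewrite expg0.
  by rewrite expgS mulSn (leq_trans (flenM _ _)) // leq_add2l.
(* With [2 |g| + 1] copies, a gain of one letter per copy would exceed the error [2 |g|]. *)
have := bound (flen g + flen g).+1; rewrite leqNgt; apply: contraNleq.
nia.
Qed.

End FreeGroupLength.

(** * The word metric of a symmetric generating set *)

Section WordDist.
Variables (G : groupType) (Q : set G).
Local Open Scope group_scope.
Hypotheses (genQ : generates Q) (symQ : Q = [set q^-1 | q in Q]).

Lemma path_lengthM (g h : G) n m :
  path_length Q 1 g n -> path_length Q 1 h m -> path_length Q 1 (g * h) (n + m).
Proof.
move=> [s [<- sQ ->]] [t [<- tQ ->]]; exists (s ++ t); split.
- by rewrite size_cat.
- by move=> q; rewrite mem_cat => /orP[/sQ|/tQ].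
- by rewrite !mul1g big_cat.
Qed.

Lemma path_length1 (q : G) : Q q -> path_length Q 1 q 1.
Proof.
move=> Qq; exists [:: q]; split; rewrite ?big_seq1 ?mul1g // => p.
by rewrite inE => /eqP ->.
Qed.

Lemma path_length0 : path_length Q 1 (1 : G) 0.
Proof. by exists [::]; rewrite big_nil mulg1. Qed.

Lemma path_lengthV (g : G) n : path_length Q 1 g n -> path_length Q 1 g^-1 n.
Proof.
move=> [s [<- + ->]]; rewrite mul1g; elim: s => [_|q s IHs sQ] /=.
  by rewrite big_nil invg1; exact: path_length0.
rewrite big_cons invgM -addn1; apply: path_lengthM.
  by apply: IHs => p ps; apply: sQ; rewrite inE ps orbT.
apply: path_length1; rewrite symQ; exists q => //; apply: sQ.
by rewrite inE eqxx.
Qed.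

(** The elements reached by paths from 1 form a subgroup containing [Q]; inverses come from
    [symQ]. *)
Lemma path_length_ex (g : G) : exists n, path_length Q 1 g n.
Proof.
pose H : {pred G} := [pred h : G | `[< exists n, path_length Q 1 h n >]].
suff : g \in H by move=> /asboolP.
apply: genQ => [|q Qq]; last by apply/asboolP; exists 1%N; exact: path_length1.
split; first by apply/asboolP; exists 0%N; exact: path_length0.
move=> h k /asboolP[n hn] /asboolP[m km]; apply/asboolP; exists (n + m)%N.
by apply: path_lengthM => //; exact: path_lengthV.
Qed.

(** Generation rules out the default value 0 of [word_dist]. *)
Lemma word_distP (g : G) : path_length Q 1 g (word_dist Q 1 g).
Proof.
rewrite /word_dist; case: pselect => [ex|[]]; first by case: ex_minnP => n /asboolP.
by have [n gn] := path_length_ex g; exists n; apply/asboolP.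
Qed.

Lemma word_dist_min (g : G) n : path_length Q 1 g n -> (word_dist Q 1%g g <= n)%N.
Proof.
move=> gn; rewrite /word_dist; case: pselect => [ex|//].
by case: ex_minnP => m _; apply; apply/asboolP.
Qed.

Lemma word_distM (g h : G) :
  (word_dist Q 1%g (g * h)%g <= word_dist Q 1%g g + word_dist Q 1%g h)%N.
Proof. by apply/word_dist_min/path_lengthM; exact: word_distP. Qed.

Lemma word_dist1 : word_dist Q 1 (1 : G) = 0%N.
Proof. by apply/eqP; rewrite -leqn0; exact/word_dist_min/path_length0. Qed.

End WordDist.

Section OuterLength.
Variable r : nat.
Local Open Scope group_scope.

(* Representatives of a product and the product of representatives differ by an
   inner automorphism, whence the conjugating element. *)
Lemma flen_outg_prod (K : nat) (s : seq (outg (free_group r))) :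
  (forall q, q \in s -> forall u, (flen (repr q u) <= K * flen u)%N) ->
  forall u, exists g,
    (flen (g * repr (\prod_(q <- s) q) u * g^-1)%g <= K ^ size s * flen u)%N.
Proof.
elim: s => [_ u|q s IHs sK u].
  rewrite big_nil; have /to_outP[w ->] : to_out (repr (1 : outg (free_group r))) = to_out 1.
    exact: to_outK.
  by exists w^-1; rewrite /= mul1n invgK -!mulgA mulVg mulg1 mulKg.
have [|g hg] := IHs _ u; first by move=> p ps; apply: sK; rewrite inE ps orbT.
rewrite big_cons; set h := \prod_(p <- s) p in hg *.
have /to_outP[w ->] : to_out (repr (q * h)) = to_out (repr q * repr h).
  by rewrite to_outM !to_outK.
(* [w^-1] undoes the discrepancy between representatives, and [repr q g] is the conjugator [g]
   carried through [repr q]. *)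
exists (repr q g * w^-1).
have -> : repr q g * w^-1 * (inner w * (repr q * repr h)) u * (repr q g * w^-1)^-1 =
    repr q (g * repr h u * g^-1).
  rewrite !autgE /= !autgM invgM invgK.
  have -> : repr q g^-1 = (repr q g)^-1.
    apply: (mulgI (repr q g)); rewrite -autgM !mulgV.
    by apply: (mulgI (repr q 1)); rewrite -autgM !mulg1.
  by rewrite !mulgA mulgVK mulgVK.
by rewrite expnS -mulnA (leq_trans (sK q (mem_head _ _) _)) // leq_mul2l hg orbT.
Qed.

End OuterLength.

(** * Cancellation-free images and their growth *)

Section NielsenWords.
Variable r : nat.
Local Notation S := (nielsen r).
Local Notation L := (letter r).
Local Notation src := (@nielsen_src r).
Local Notation mul := (@nielsen_mul r).
Implicit Types (s t : S) (a b z : L) (u : seq L) (w : nat -> S).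

(** A list instead of a group element, so that nothing cancels. *)
Definition subst_letter s z : seq L :=
  if z == src s then [:: mul s; src s]
  else if z == linv (src s) then [:: linv (src s); linv (mul s)] else [:: z].

Definition subst s u : seq L := flatten [seq subst_letter s z | z <- u].

(* The pair of letters a b takes the turn {a^-1, b}. After [x |-> yx] the only
   turn containing x is {x, y^-1}. *)
Definition legal s : rel L := fun a b =>
  [&& b != linv a, (a == linv (src s)) ==> (b == linv (mul s)) &
      (b == src s) ==> (a == mul s)].

Lemma nielsen_neq s : mul s != src s /\ mul s != linv (src s).
Proof. by have /andP[] := nielsen_okP s. Qed.

Lemma linv_swap a b : (a == linv b) = (linv a == b).
Proof. by rewrite -linv_eq linvK. Qed.

(** Write [s = [x |-> yx]] and [t = [x' |-> y'x']]. Cancellation at the new junction needs the old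
    turn to be [{x', y'}]. By admissibility this pair consists of [x] and a letter other than
    [y^-1], whereas a legal turn containing [x] is [{x, y^-1}]. *)
Lemma legal_junction s t a b : admissible s t -> legal s a b ->
  legal t (last a (subst_letter t a)) (head b (subst_letter t b)).
Proof.
move=> st /and3P[ab a1 b1].
have [yx yxV] := nielsen_neq t.
have Vx : linv (mul t) != linv (src t) by rewrite linv_eq.
have -> : last a (subst_letter t a) = if a == linv (src t) then linv (mul t) else a.
  rewrite /subst_letter; have [->|_] := eqVneq a (src t); last by case: eqVneq.
  by rewrite [src t == _]eq_sym (negbTE (linv_neq _)).
have -> : head b (subst_letter t b) = if b == src t then mul t else b.
  rewrite /subst_letter; have [//|_] := eqVneq b (src t).
  by case: eqVneq.
have adm : src t = src s /\ mul t != linv (mul s) \/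
           mul t = src s /\ src t != linv (mul s).
  by move: st; rewrite /admissible => /orP[] /andP[/eqP -> ->]; [left|right].
rewrite /legal; case: (eqVneq a (linv (src t))) => [ea|na];
  case: (eqVneq b (src t)) => [eb|nb].
- by rewrite ea eb linvK eqxx in ab.
- rewrite (negbTE Vx) (negbTE nb) /= andbT linvK; apply/eqP => eb.
  case: adm => -[e ne].
    by move: a1; rewrite ea e eqxx eb (negbTE ne).
  move: b1; rewrite eb e eqxx ea /= => /eqP e'.
  by rewrite -e' linvK eqxx in ne.
- rewrite (negbTE yx) (negbTE na) /= andbT; apply/eqP => ea.
  have {}ea : a = linv (mul t) by rewrite ea linvK.
  case: adm => -[e ne].
    move: b1; rewrite eb e eqxx ea /= => /eqP e'.
    by rewrite -e' linvK eqxx in ne.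
  by move: a1; rewrite ea e eqxx eb (negbTE ne).
- by rewrite ab (negbTE na) (negbTE nb).
Qed.

Lemma subst_letter_neq0 s a : subst_letter s a != [::].
Proof. by rewrite /subst_letter; case: ifP => // _; case: ifP. Qed.

(** The only turn inside the images [yx] and [x^-1 y^-1] is [{x, y^-1}], the permitted one. *)
Lemma subst_letter_legal s a : sorted (legal s) (subst_letter s a).
Proof.
have [yx yxV] := nielsen_neq s.
have xyV : src s != linv (mul s) by rewrite linv_swap eq_sym.
rewrite /subst_letter; case: ifP => _; [|case: ifP => _ //]; rewrite /= /legal.
  by rewrite xyV (negbTE yxV) !eqxx.
by rewrite linvK !eqxx [linv _ == src _]eq_sym (negbTE xyV).
Qed.

Lemma cycle_legal_subst s t u : admissible s t ->
  cycle (legal s) u -> cycle (legal t) (subst t u).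
Proof.
move=> st; apply: cycle_flatten; [exact: subst_letter_neq0|exact: subst_letter_legal|].
by move=> a b; exact: legal_junction.
Qed.

Lemma cycle_legal_reduced s u : cycle (legal s) u -> cycle (@cyclically_reduced r) u.
Proof. by apply: sub_cycle => a b /and3P[]. Qed.

Local Open Scope group_scope.

Lemma fg_word_nielsen s (u : free_group r) :
  reduced (subst s (fg_word u)) -> fg_word (nielsen_aut s u) = subst s (fg_word u).
Proof.
move=> red; rewrite -[RHS]foldr_reduced // -fg_word_prod_gen; congr fg_word.
rewrite /= /nielsen_fun /fg_lift /subst big_flatten big_map.
apply: eq_bigr => z _; rewrite /nielsen_img /subst_letter.
do 2![case: ifP => _; first by rewrite !big_cons big_nil /= mulg1 ?fg_gen_linv].
by rewrite big_seq1.
Qed.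

Fixpoint formal_image w u n : seq L :=
  if n is n'.+1 then subst (w n') (formal_image w u n') else u.

Definition walk_aut w n : autg (free_group r) :=
  iteri n (fun i phi => nielsen_aut (w i) * phi) 1.

Lemma to_out_walk w n : to_out (walk_aut w n) = walk w n.
Proof. by elim: n => //= n <-; rewrite to_outM. Qed.

Lemma walkD w n m : walk w (n + m) = walk (fun i => w (n + i)%N) m * walk w n.
Proof.
elim: m => [|m IHm]; first by rewrite addn0 mul1g.
by rewrite addnS /= IHm mulgA.
Qed.

Lemma cycle_reduced u : cycle (@cyclically_reduced r) u -> reduced u.
Proof. by case: u => // a p; rewrite /= rcons_path => /andP[]. Qed.

(* The letter y survives [x |-> yx] unchanged, and all its later images are
   taken without cancellation. *)
Lemma formal_image_walk w n : (forall i, admissible (w i) (w i.+1)) ->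
  cycle (legal (w n)) (formal_image w [:: mul (w 0%N)] n.+1) /\
  fg_word (walk_aut w n.+1 (fg_gen (mul (w 0%N)))) =
    formal_image w [:: mul (w 0%N)] n.+1.
Proof.
move=> adm; have [yx yxV] := nielsen_neq (w 0%N).
elim: n => [|n [IHc IHw]].
  have E : subst (w 0%N) [:: mul (w 0%N)] = [:: mul (w 0%N)].
    by rewrite /subst /subst_letter /= (negbTE yx) (negbTE yxV).
  rewrite [formal_image _ _ _]E; split; last by rewrite /= fg_word_nielsen E.
  (* The one-letter cycle pairs [y] with itself, which is legal because [y] differs from [x] and
     [x^-1]. *)
  by rewrite /= /legal (negbTE yx) (negbTE yxV) eq_sym linv_neq.
have c : cycle (legal (w n.+1)) (formal_image w [:: mul (w 0%N)] n.+2).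
  exact: cycle_legal_subst IHc.
split=> //; rewrite -[walk_aut w n.+2]/(nielsen_aut (w n.+1) * walk_aut w n.+1) autgE.
rewrite fg_word_nielsen IHw //; exact/cycle_reduced/cycle_legal_reduced/c.
Qed.

Local Close Scope group_scope.
Local Open Scope nat_scope.

Definition occ (i : 'I_r) u : nat := count (fun z => z.1 == i) u.

Lemma occ_cat i u v : occ i (u ++ v) = occ i u + occ i v.
Proof. exact: count_cat. Qed.

Lemma size_occ u : size u = \sum_i occ i u.
Proof.
elim: u => [|a u IHu]; first by rewrite big1.
transitivity (\sum_i ((a.1 == i : nat) + occ i u)); last by apply: eq_bigr.
rewrite big_split /= -IHu (bigD1 a.1) //= eqxx big1 ?addn0 // => i.
by rewrite eq_sym => /negbTE ->.
Qed.

Lemma subst_cons s a u : subst s (a :: u) = subst_letter s a ++ subst s u.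
Proof. by []. Qed.

Lemma size_subst s u : size (subst s u) = size u + occ (src s).1 u.
Proof.
have size_letter a : size (subst_letter s a) = 1 + (a.1 == (src s).1).
  rewrite /subst_letter; case: (src s) a => j c [i b]; rewrite /linv !xpair_eqE /=.
  by case: eqVneq => // _; case: b c => [] [].
elim: u => // a u IHu; rewrite subst_cons size_cat IHu size_letter.
by rewrite -[occ _ (a :: u)]/((a.1 == _ : nat) + occ _ u) /=; lia.
Qed.

(** The formal image of a letter contains that letter. *)
Lemma occ_subst i s u : occ i u <= occ i (subst s u).
Proof.
elim: u => // a u IHu; rewrite -[occ i (a :: u)]/((a.1 == i : nat) + occ i u).
rewrite subst_cons occ_cat leq_add // /subst_letter.
have [->|_] := eqVneq a (src s); first by rewrite /occ /= addn0 leq_addl.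
by have [->|_] := eqVneq a (linv (src s)); rewrite /occ /= ?addn0 // leq_addr.
Qed.

Definition formal_block (l : seq S) u := foldl (fun v s => subst s v) u l.

Lemma occ_block i l u : occ i u <= occ i (formal_block l u).
Proof. by elim: l u => //= s l IHl u; exact: leq_trans (occ_subst i s u) (IHl _). Qed.

(** A step with source index [i] adds the current number of letters of index [i], which is at least
    the initial one. An index that recurs in [l] is counted once. *)
Lemma size_block l u :
  size u + \sum_(i | i \in [seq (src s).1 | s <- l]) occ i u <= size (formal_block l u).
Proof.
elim/last_ind: l => [|l s IHl]; first by rewrite big_pred0 ?addn0.
rewrite /formal_block foldl_rcons size_subst -/(formal_block l u).
rewrite (leq_trans _ (leq_add IHl (occ_block _ l u))) // -addnA leq_add2l map_rcons.
set j := (src s).1; set l' := map _ _.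
rewrite (eq_bigl (fun i => (i == j) || (i \in l'))); last first.
  by move=> i; rewrite mem_rcons inE.
rewrite (bigD1 j) ?eqxx //= addnC leq_add2r.
rewrite big_mkcond [leqRHS]big_mkcond leq_sum // => i _.
by case: (i == j) => //=; rewrite ?andbT ?andbF //; case: ifP.
Qed.

Lemma block_doubles l u : (forall i, i \in [seq (src s).1 | s <- l]) ->
  2 * size u <= size (formal_block l u).
Proof.
move=> li; rewrite mul2n -addnn (leq_trans _ (size_block l u)) // leq_add2l.
by rewrite {1}size_occ [leqRHS](eq_bigl xpredT).
Qed.

Lemma formal_imageD w u n k :
  formal_image w u (n + k) = formal_block [seq w (n + i) | i <- iota 0 k] (formal_image w u n).
Proof.
elim: k => [|k IHk]; first by rewrite addn0.
by rewrite -[in RHS]addn1 iotaD map_cat /formal_block foldl_cat addnS /= IHk.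
Qed.

Lemma size_formal_imageS w u n : size (formal_image w u n) <= size (formal_image w u n.+1).
Proof. by rewrite /= size_subst leq_addr. Qed.

Lemma size_formal_image_mono w u n k :
  size (formal_image w u n) <= size (formal_image w u (n + k)).
Proof.
by elim: k => [|k IHk]; rewrite ?addn0 // addnS (leq_trans IHk) // size_formal_imageS.
Qed.

Lemma size_formal_image_gt0 w z n : 0 < size (formal_image w [:: z] n).
Proof. exact: leq_trans (size_formal_image_mono w [:: z] 0 n). Qed.

(* Each visit to the block l at time i doubles the length between times i and
   i + size l; the product telescopes. *)
Lemma block_growth w z (l : seq S) n : (forall i, i \in [seq (src s).1 | s <- l]) ->
  2 ^ (\sum_(i < n) ([seq w (i + j) | j <- iota 0 (size l)] == l)) <=
    size (formal_image w [:: z] (n + size l)) ^ size l.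
Proof.
move=> li; pose visit i := [seq w (i + j) | j <- iota 0 (size l)] == l.
rewrite -[\sum_(i < n) _]/(\sum_(i < n) visit i); set k := size l; pose len i := size (formal_image w [:: z] i).
have len0 i : 0 < len i by exact: size_formal_image_gt0.
have step i : 2 ^ visit i * len i <= len (i + k).
  rewrite /len /visit formal_imageD; case: eqP => [->|_].
    exact: block_doubles.
  by rewrite mul1n -formal_imageD size_formal_image_mono.
(* Products over a window of [k] consecutive lengths: moving the window by one trades [len n] for
   [len (n + k)], so overlapping visits do no harm. *)
have tele : 2 ^ (\sum_(i < n) visit i) * \prod_(i < k) len i <= \prod_(i < k) len (n + i).
  elim: n => [|n IHn]; first by rewrite big_ord0 mul1n.
  rewrite big_ord_recr expnD mulnAC (leq_trans (leq_mul IHn (leqnn _))) //=.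
  case: (k) (step n) => [|k'] h.
    by rewrite !big_ord0 mul1n -(leq_pmul2r (len0 n)) mul1n; rewrite addn0 in h.
  rewrite big_ord_recl [leqRHS]big_ord_recr /= addn0 mulnC mulnA.
  rewrite [leqRHS]mulnC leq_mul ?addSnnS //.
  by under eq_bigr do rewrite -addSnnS.
(* The initial window is at least 1, and every length in the final one is at most [len (n + k)]. *)
apply: (@leq_trans (\prod_(i < k) len (n + i))).
  apply: leq_trans tele; rewrite leq_pmulr // prodn_gt0 // => i; exact: len0.
apply: (@leq_trans (\prod_(i < k) len (n + k))).
  apply: leq_prod => i _; rewrite (_ : n + k = n + i + (k - i)).
    exact: size_formal_image_mono.
  by rewrite -addnA subnKC // ltnW.
by rewrite prod_nat_const card_ord.
Qed.

End NielsenWords.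

(** * Irreducibility of the chain *)

Section Irreducible.
Variables (r : nat) (hr : (2 < r)%N).
Local Notation S := (nielsen r).
Local Notation src := (@nielsen_src r).
Local Notation mul := (@nielsen_mul r).
Implicit Types s t : S.

Lemma exists_index (i j : 'I_r) : exists k, (k != i) && (k != j).
Proof.
have : (0 < #|~: [set i; j]%SET|)%N.
  rewrite -(leq_add2l #|[set i; j]%SET|) cardsC card_ord addn1.
  by rewrite (leq_ltn_trans _ hr) // cards2; case: (_ != _).
by move/card_gt0P => [k]; rewrite !inE negb_or => h; exists k.
Qed.

Lemma exists_nielsen (x y : letter r) : y.1 != x.1 -> exists s, src s = x /\ mul s = y.
Proof.
move=> yx; have ok : nielsen_ok (x, y).
  by apply/andP; split=> /=; apply: contraNneq yx => ->.
by exists (exist _ (x, y) ok).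
Qed.

(** One step suffices unless the multipliers are mutually inverse; then a multiplier from a third
    generator serves as a stopover. *)
Lemma connect_same_src s t : src s = src t -> connect (@admissible r) s t.
Proof.
move=> st; have [e|ne] := eqVneq (mul t) (linv (mul s)); last first.
  by apply: connect1; rewrite /admissible st eqxx ne.
have [k /andP[kx ky]] := exists_index (src s).1 (mul s).1.
have [m [msrc mmul]] := exists_nielsen (x := src s) (y := (k, false)) kx.
apply: (@connect_trans _ _ m); apply: connect1; rewrite /admissible.
  by rewrite msrc eqxx mmul; apply/orP; left; apply: contraNneq ky => /(congr1 fst) /= ->.
rewrite msrc st eqxx e linv_eq mmul; apply/orP; left.
by apply: contraNneq ky => /(congr1 fst) /= ->.
Qed.

(** With [z] the source of [s], [[z |-> xz]] may be followed by [[x |-> zx]]. *)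
Lemma connect_src s (x : letter r) : x.1 != (src s).1 ->
  exists2 t, src t = x & connect (@admissible r) s t.
Proof.
move=> xs; have [m [msrc mmul]] := exists_nielsen xs.
have sx : (src s).1 != x.1 by rewrite eq_sym.
have [t [tsrc tmul]] := exists_nielsen sx.
exists t => //; apply: (@connect_trans _ _ m).
  by apply: connect_same_src; rewrite msrc.
apply: connect1; rewrite /admissible tmul msrc tsrc mmul eqxx.
by apply/orP; right; rewrite eq_sym linv_neq.
Qed.

Lemma connect_admissible s t : connect (@admissible r) s t.
Proof.
have [st|st] := eqVneq (src t).1 (src s).1; last first.
  have [u ut su] := connect_src st.
  by apply: (connect_trans su); exact: connect_same_src.
(* The sources may be mutually inverse, which [connect_src] does not join directly; hence a detour
   through another generator. *)
have [k /andP[ks _]] := exists_index (src s).1 (src s).1.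
have [u us su] := connect_src (s := s) (x := (k, false)) ks.
have tu : (src t).1 != (src u).1 by rewrite us st eq_sym.
have [v vt uv] := connect_src tu.
apply: (connect_trans su); apply: (connect_trans uv).
exact: connect_same_src.
Qed.

Lemma exists_full_path (s : S) : exists p, path (@admissible r) s p /\ forall t, t \in s :: p.
Proof.
suff H (ts : seq S) s' : exists p, path (@admissible r) s' p /\ {subset ts <= s' :: p}.
  by have [p [sp h]] := H (enum {: S}) s; exists p; split=> // t; apply: h; rewrite mem_enum.
elim: ts s' => [|t ts IHts] s'; first by exists [::].
have /connectP[p1 sp1 te] := connect_admissible s' t.
have [p2 [tp2 h2]] := IHts t; exists (p1 ++ p2); rewrite cat_path sp1 -te; split=> //.
move=> v; rewrite inE -cat_cons mem_cat => /predU1P[->|/h2].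
  by rewrite te mem_last.
by rewrite inE => /predU1P[->|->]; rewrite ?orbT // te mem_last.
Qed.

End Irreducible.

(** * Word length bounds the growth of formal images *)

Section WalkLength.
Variables (r : nat) (Q : set (outg (free_group r))).
Hypotheses (finQ : finite_set Q) (genQ : generates Q) (symQ : Q = [set (q^-1)%g | q in Q]).
Local Notation S := (nielsen r).
Implicit Type w : nat -> S.

Definition walk_length n w : nat := word_dist Q 1%g (walk w n).

Lemma walk_ext n w w' : (forall i, (i < n)%N -> w i = w' i) -> walk w n = walk w' n.
Proof.
elim: n => // n IHn ww'; rewrite /walk /= ww' //; congr (_ * _)%g.
by apply: IHn => i ni; apply: ww'; exact: leqW.
Qed.

(** A common Lipschitz constant for the representatives of [Q], taken as a power of 2 so that
    exponents can be compared later. *)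
Lemma finite_lip : exists K, forall q, Q q -> forall u, (flen (repr q u) <= 2 ^ K * flen u)%N.
Proof.
exists (\max_(q <- finmap.enum_fset (fset_set Q)) lip (repr q))%N => q Qq u.
rewrite (leq_trans (flen_lip _ u)) // leq_mul2r; apply/orP; right.
rewrite (leq_trans _ (ltnW (ltn_expl _ (ltnSn 1)))) //.
by apply: leq_bigmax_seq => //; rewrite in_fset_set // mem_set.
Qed.

(** A shortest word in [Q] for the walk shows that some conjugate of the image of the first
    multiplier is at most this long. The image itself is cyclically reduced, hence no longer than
    its conjugates. *)
Lemma formal_image_walk_length K w n : (forall i, admissible (w i) (w i.+1)) ->
  (forall q, Q q -> forall u, (flen (repr q u) <= 2 ^ K * flen u)%N) ->
  (size (formal_image w [:: nielsen_mul (w 0%N)] n.+1) <= 2 ^ (K * walk_length n.+1 w))%N.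
Proof.
move=> adm QK; rewrite /walk_length; have [cyc img] := formal_image_walk n adm.
have [s [<- sQ]] := word_distP genQ symQ (walk w n.+1).
rewrite mul1g => ws.
set y := fg_gen _ in img.
have [|g] := @flen_outg_prod r (2 ^ K) s _ y; first by move=> q /sQ; exact: QK.
rewrite -ws muln1 -expnM; apply: leq_trans.
have /to_outP[v ->] : to_out (repr (walk w n.+1)) = to_out (walk_aut w n.+1).
  by rewrite to_outK to_out_walk.
rewrite -img -[size _]/(flen _).
have -> : (g * (inner v * walk_aut w n.+1) y * g^-1 =
    (g * v) * walk_aut w n.+1 y * (g * v)^-1)%g.
  by rewrite autgE /= invgM !mulgA.
apply: cyclically_reduced_min; rewrite img.
exact: cycle_legal_reduced cyc.
Qed.

End WalkLength.

(** * Convergence and positivity *)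

Section Rate.
Variables (R : realType) (r : nat) (hr : (2 < r)%N).
Variable Q : set (outg (free_group r)).
Hypotheses (finQ : finite_set Q) (genQ : generates Q) (symQ : Q = [set (q^-1)%g | q in Q]).
Local Notation S := (nielsen r).
Local Notation Om := (trajectories hr).
Variable P : probability Om R.
Hypothesis chainP : is_chain_law P.
Let X n (w : Om) := walk_length Q n w.

Lemma measurable_walk_length n : measurable_fun setT (X n).
Proof.
move=> _ Y _; rewrite setTI; apply: (@measurable_finite_dep _ _ n) => w w' ww'.
by rewrite /preimage /= /X /walk_length (walk_ext ww').
Qed.

Lemma subadditive_walk_length : subadditive_cocycle (@traj_shift r hr) X.
Proof.
move=> n m w; rewrite /X /walk_length walkD addnC.
rewrite (leq_trans (word_distM genQ symQ _ _)) // leq_add2r /walk_length.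
by rewrite (@walk_ext r m _ (iter n (@traj_shift r hr) w)) // => i _; rewrite iter_shiftE.
Qed.

(** Stationarity moves time [i] to time 0, where an inadmissible pair has probability 0. *)
Lemma ae_admissible : {ae P, forall w : Om, forall i, admissible (w i) (w i.+1)}.
Proof.
apply: ae_foralln => i; pose A := [set w : Om | ~ admissible (w 0%N) (w 1%N)].
have mA : measurable A.
  by apply: (@measurable_finite_dep _ _ 2) => w w' ww'; rewrite /A /= !ww'.
exists (iter i (@traj_shift r hr) @^-1` A); split.
- exact: (measurable_iter_preimage (@measurable_traj_shift r hr)).
- rewrite [LHS](iter_preserving (@measurable_traj_shift r hr) (shift_preserving chainP)) //.
  rewrite (probability_split P 0) // big1 // => a _.
  rewrite (probability_split P 1); last first.
    by apply: measurableI => //; exact: (measurable_coordinate 0 [set a]).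
  rewrite big1 // => b _; pose s j := if j is 0%N then a else b.
  have [ab|nab] := boolP (admissible a b).
    rewrite (_ : _ `&` _ = set0) ?measure0 //; apply/seteqP; split=> // w [[Aw /= wa] wb].
    by apply: Aw; rewrite wa wb.
  apply: (subset_measure0 _ (measurable_cylinder 1 s)).
  + apply: measurableI; last exact: (measurable_coordinate 1 [set b]).
    by apply: measurableI => //; exact: (measurable_coordinate 0 [set a]).
  + by move=> w [[_ /= wa] wb] [|[|//]].
  + by rewrite [LHS](cylinderE chainP) big_ord1 /= /chain_trans (negbTE nab) mulr0.
- by move=> w /= nadm; rewrite /preimage /A /= !iter_shiftE addn0 addn1.
Qed.

Lemma cylinder_gt0 a p : path (@admissible r) a p ->
  (0 < P (@cylinder r hr (size p) (nth a (a :: p))))%E.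
Proof.
move=> ap; rewrite (cylinderE chainP) lte_fin mulr_gt0 ?invr_gt0 ?(card_nielsen_gt0 R hr) //.
apply: prodr_gt0 => i _; rewrite /chain_trans.
have -> : admissible (nth a (a :: p) i) (nth a (a :: p) i.+1).
  by move/pathP: ap => /(_ a); apply.
by rewrite invr_gt0 lt_neqAle eq_sym (degree_neq0 R hr) ler0n.
Qed.

Lemma walk_length_rate : exists c : R, 0 < c /\
  {ae P, forall w : Om, (X n w)%:R / n%:R @[n --> \oo] --> c}.
Proof.
pose f := @traj_shift r hr.
have mf : measurable_fun setT f := @measurable_traj_shift r hr.
have Pf : forall A, measurable A -> P (f @^-1` A) = P A := shift_preserving chainP.
have erg A : measurable A -> f @^-1` A `<=` A -> P A = 0%E \/ P A = 1%E.
  by apply: zero_one_shift => // s t; exact: connect_admissible.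
pose B := (\max_(s : S) word_dist Q 1%g (to_out (nielsen_aut s)))%N.
have X1 w : (X 1%N w <= B)%N.
  by rewrite /X /walk_length /walk /= mulg1; exact: (leq_bigmax (w 0%N)).
have [c cvX] := kingman mf Pf erg measurable_walk_length
  (fun w => word_dist1 Q) subadditive_walk_length X1.
exists c; split=> //.
have [a _] := nielsen_inhabited hr.
have [p [ap full]] := exists_full_path hr a.
pose l := a :: p; pose k := size l.
have lidx i : i \in [seq (nielsen_src s).1 | s <- l].
  have [j /andP[ji _]] := exists_index hr i i.
  have [s [ssrc _]] := @exists_nielsen r (i, false) (j, false) ji.
  by apply/mapP; exists s; rewrite ?ssrc.
(* [cylinder (size p)] prescribes [size p + 1 = k] states, so visits to [E] are the occurrences of
   the block [l]. *)
pose E := @cylinder r hr (size p) (nth a l).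
have mE : measurable E by exact: measurable_cylinder.
have EE i (w : Om) : (iter i f w \in E) = ([seq w (i + j)%N | j <- iota 0 k] == l).
  apply/idP/eqP => [/set_mem Ew|wl].
    apply: (@eq_from_nth _ a); rewrite size_map size_iota // => j jk.
    by rewrite (nth_map 0%N) ?size_iota // nth_iota // -iter_shiftE Ew.
  apply/mem_set => j jp; rewrite iter_shiftE -wl (nth_map 0%N) ?size_iota ?ltnS //.
  by rewrite nth_iota.
have PE0 : (0 < P E)%E by exact: cylinder_gt0.
pose q := fine (P E) / 2.
have PEE : P E = (fine (P E))%:E by rewrite fineK // fin_num_measure.
have p0 : 0 < fine (P E) by rewrite -lte_fin -PEE.
have q0 : 0 < q by rewrite divr_gt0.
have qE : (q%:E < P E)%E.
  by rewrite PEE lte_fin /q; lra.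
have [K QK] := finite_lip finQ.
(* The exponents will give [q * n <= K.+1 * k * X (n + k)], and the 2 covers [n + k <= 2 * n].
   [K.+1] keeps the denominator positive when [K = 0]. *)
pose delta := q / (2 * (K.+1 * k)%:R).
have kK0 : 0 < (K.+1 * k)%:R :> R by rewrite ltr0n.
have delta0 : 0 < delta by rewrite divr_gt0 // mulr_gt0.
(* As [c] is a constant, one trajectory with all three almost sure properties suffices to bound it
   below. *)
have [w [cw [adm freq]]] : exists w : Om, (X n w)%:R / n%:R @[n --> \oo] --> c /\
    ((forall i, admissible (w i) (w i.+1)) /\
     \forall n \near \oo, q * n%:R < (visits f E n w)%:R).
  apply: (@filter_ex _ (almost_everywhere P)).
    apply: ae_properfilter_algebraOfSetsType.
    by rewrite [X in (_ < X)%E](_ : _ = 1%E) ?lte01 //; exact: probability_setT.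
  by apply: filterI => //; apply: filterI; [exact: ae_admissible|exact: visits_frequency].
suff : delta <= c by exact: lt_le_trans.
rewrite leNgt; apply/negP => cd; have [N1 _ small] := cvgr_lt c cw _ cd.
have [N2 _ visited] := freq.
pose n := (N1 + N2 + k).+1.
have N1n : (N1 <= n)%N by rewrite /n -addnA -addnS leq_addr.
have N2n : (N2 <= n)%N by rewrite /n addnAC -addSn leq_addl.
have kn : (k <= n)%N by rewrite /n -addSn leq_addl.
have v : q * n%:R < (visits f E n w)%:R := visited n N2n.
have : (X (n + k) w)%:R / (n + k)%:R < delta := small (n + k)%N (leq_trans N1n (leq_addr _ _)).
rewrite ltNge => /negP; apply.
have nk0 : 0 < (n + k)%:R :> R by rewrite ltr0n addSn.
(* Compare exponents of 2: [block_growth] bounds the visits by the [k]-th power of the formal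
   length, which is at most [2 ^ (K * X (n + k))]. *)
have v2 : (visits f E n w <= K.+1 * k * X (n + k) w)%N.
  rewrite -(@leq_exp2l 2) //.
  have := block_growth w (nielsen_mul (w 0%N)) n lidx.
  rewrite -/k (_ : (\sum_(i < n) _)%N = visits f E n w); last first.
    by apply: eq_bigr => i _; rewrite EE.
  move=> /leq_trans; apply.
  have := formal_image_walk_length genQ symQ (n + k).-1 adm QK.
  rewrite [(n + k).-1.+1]prednK ?addSn // => h.
  rewrite -mulnA mulnCA mulnC expnM leq_exp2r // (leq_trans h) //.
  by rewrite leq_exp2l // leq_mul2r leqnSn orbT.
have nk : (n + k)%:R <= 2 * n%:R :> R by rewrite -natrM ler_nat mul2n -addnn leq_add2l.
have halve (C : R) : 0 < C -> C * (q / (2 * C)) = q / 2.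
  by move=> C0; field; rewrite gt_eqF.
rewrite ler_pdivlMr // -(ler_pM2l kK0) mulrA halve //.
apply: (@le_trans _ _ (visits f E n w)%:R); last by rewrite -natrM ler_nat.
apply: le_trans (ltW v); rewrite -mulrA ler_pM2l //.
by rewrite ler_pdivrMl.
Qed.

End Rate.

Theorem theorem2 (R : realType) (r : nat) (hr : (3 <= r)%N)
    (Q : set (outg (free_group r))) (finQ : finite_set Q)
    (genQ : generates Q) (symQ : Q = [set (q^-1)%g | q in Q]) :
  exists c : R, 0 < c /\
    {ae chain_measure R hr, forall w : trajectories hr,
      (word_dist Q 1%g (walk w n))%:R / n%:R @[n --> \oo] --> c}.
Proof. exact (walk_length_rate finQ genQ symQ (chain_measureP R hr)). Qed.
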